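(* Let $(X,d)$ be a complete uniform Busemann NPC space. Let $H:[0,\infty)\to\mathbb{R}$ be continuous, non-decreasing and convex with $H(0)=0$ and $H(p)/p\to\infty$ as $p\to\infty$. Let $u_0:X\to\mathbb{R}$ be Lipschitz continuous and let $u\in C(X\times[0,\infty))$ be the unique metric viscosity solution (in the class of continuous functions satisfying the linear growth condition given in the context) of $$\partial_t u+H(|\nabla u|)=0\ \text{ in } X\times(0,\infty),\qquad u(\cdot,0)=u_0\ \text{ in } X.$$ If $u_0$ is weakly geodesically convex, then $u(\cdot,t)$ is weakly geodesically convex for all $t\ge0$.
   Context: Geodesic spaces. A metric space $(X,d)$ is geodesic if any $x,y\in X$ are joined by a curve $\gamma:[0,1]\to X$ with $\gamma_0=x$, $\gamma_1=y$, $d(\gamma_s,\gamma_t)=|s-t|d(x,y)$. $M(x,y)=\{z\in X: d(x,z)=d(y,z)=d(x,y)/2\}$ is the set of midpoints. $B_r(p)$ is the closed ball. A geodesic space is a uniform Busemann NPC space if there exists $\delta>0$ such that for every $p\in X$ and all $x,y,y'\in B_\delta(p)$: $2d(z,z')\le d(y,y')$ for all $z\in M(x,y)$ and $z'\in M(x,y')$. A continuous $f:X\to\mathbb{R}$ is weakly geodesically convex if $\inf_{z\in M(x,y)}2f(z)\le f(x)+f(y)$ for all $x,y\in X$. Slopes. For $u$ on $X\times(0,\infty)$, $|\nabla u|(x,t)=\limsup_{y\to x}\frac{|u(y,t)-u(x,t)|}{d(x,y)}$ and $|\nabla^\pm u|(x,t)=\limsup_{y\to x}\frac{[u(y,t)-u(x,t)]_\pm}{d(x,y)}$,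 where $[s]_+=\max\{s,0\}$, $[s]_-=-\min\{s,0\}$. Test functions. $\mathcal{C}$ is the set of locally Lipschitz functions $\psi$ on $X\times(0,\infty)$ with $\partial_t\psi$ continuous; $\overline{\mathcal{C}}=\{\psi\in\mathcal{C}: |\nabla^+\psi|=|\nabla\psi|,\ |\nabla\psi| \text{ continuous}\}$; $\underline{\mathcal{C}}=\{\psi\in\mathcal{C}: |\nabla^-\psi|=|\nabla\psi|,\ |\nabla\psi| \text{ continuous}\}$. Metric viscosity solutions of $\partial_tu+H(|\nabla u|)=0$. For $a\ge0$, $p\geq 0$ put $H_a(p)=\inf\{H(p'):p'\ge 0,|p'-p|\le a\}$, $H^a(p)=\sup\{H(p'):p'\ge0,|p'-p|\le a\}$, and $|\nabla\psi|^*(x,t)=\limsup_{(x',t')\to(x,t)}|\nabla\psi|(x',t')$. An upper semicontinuous $u$ on $X\times(0,\infty)$ is a metric viscosity subsolution if whenever $\psi=\psi_1+\psi_2$ with $\psi_1\in\underline{\mathcal{C}}$, $\psi_2\in\mathcal{C}$ and $u-\psi$ has a local maximum at $(x,t)$, then $\partial_t\psi(x,t)+H_{|\nabla\psi_2|^*(x,t)}(|\nabla\psi_1|(x,t))\le0$. A lower semicontinuous $u$ is a metric viscosity supersolution if whenever $\psi=\psi_1+\psi_2$ with $\psi_1\in\overline{\mathcal{C}}$, $\psi_2\in\mathcal{C}$ and $u-\psi$ has a local minimum at $(x,t)$, then $\partial_t\psi(x,t)+H^{|\nabla\psi_2|^*(x,t)}(|\nabla\psi_1|(x,t))\ge0$.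 A metric viscosity solution is both. Uniqueness class: $u\in C(X\times[0,\infty))$ with $|u(x,t)|\le C(d(x_0,x)+t+1)$ for some $C<\infty$ and a fixed $x_0\in X$. It is known (Gangbo–Święch) that the solution exists, is unique in this class, and is given by the Hopf–Lax formula $u(x,t)=\inf_{a\in X}\{u_0(a)+tL(d(a,x)/t)\}$ for $t>0$, where $L(v)=\sup_{p\ge0}(pv-H(p))$, $v\ge0$. *)

(* Defs.v *)
From HB Require Import structures.
From mathcomp Require Export all_boot all_order all_algebra.
From mathcomp Require Export all_classical all_reals all_analysis.
Export Order.TTheory GRing.Theory Num.Theory.
Export numFieldNormedType.Exports.

Set Implicit Arguments.
Unset Strict Implicit.
Unset Printing Implicit Defensive.

Global Open Scope classical_set_scope.
Global Open Scope ring_scope.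

Section metric_geometry.
Context {R : realType}.

(* The library's [completeType] is pointed and has no join with [metricType],
   hence its axiom is restated as a predicate. *)
Definition complete_space (X : metricType R) : Prop :=
  forall F : set_system X, ProperFilter F -> cauchy F -> exists l : X, F --> l.

Definition geodesic_space (X : metricType R) : Prop :=
  forall x y : X, exists g : R -> X,
    [/\ g 0 = x, g 1 = y &
        forall s t, 0 <= s <= 1 -> 0 <= t <= 1 ->
          mdist (g s) (g t) = `|s - t| * mdist x y].

Definition midpoints (X : metricType R) (x y : X) : set X :=
  [set z | mdist x z = mdist x y / 2 /\ mdist y z = mdist x y / 2].

Definition closed_mball (X : metricType R) (p : X) (r : R) : set X :=
  [set x | mdist p x <= r].

Definition uniform_busemann_npc (X : metricType R) : Prop :=
  geodesic_space X /\
  exists2 delta : R, 0 < delta &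
    forall p x y y' : X,
      closed_mball p delta x -> closed_mball p delta y ->
      closed_mball p delta y' ->
      forall z z', midpoints x y z -> midpoints x y' z' ->
        2 * mdist z z' <= mdist y y'.

(* The infimum is taken in the extended reals, since [f] may be unbounded
   below on [midpoints x y]. *)
Definition weakly_geodesically_convex (X : metricType R) (f : X -> R) : Prop :=
  continuous f /\
  forall x y : X,
    (ereal_inf [set (2 * f z)%:E | z in midpoints x y] <= (f x + f y)%:E)%E.

Definition lipschitz_continuous (X : metricType R) (f : X -> R) : Prop :=
  exists K : R, forall x y : X, `|f x - f y| <= K * mdist x y.

End metric_geometry.

(* Functions on X x (0,oo) and X x [0,oo) are total functions on [X * R],
   of which only the values on the sets below are ever constrained or used. *)
Section spacetime.
Context {R : realType} (X : metricType R).

Definition open_spacetime : set (X * R) := [set q | 0 < q.2].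
Definition closed_spacetime : set (X * R) := [set q | 0 <= q.2].

(* [limf_esup _ x^'] ranges over y != x. The quotients being nonnegative, the
   maximum with 0 only matters at an isolated point x, where the limsup would
   be -oo and the slope is 0 by convention. *)
Definition limsup_quotient (phi : R -> R) (f : X -> R) (x : X) : \bar R :=
  maxe 0%E (limf_esup (fun y => (phi (f y - f x) / mdist x y)%:E) x^').

Definition pos_part (s : R) : R := Num.max s 0.
Definition neg_part (s : R) : R := - Num.min s 0.

Definition slope (u : X * R -> R) (q : X * R) : \bar R :=
  limsup_quotient Num.norm (fun y => u (y, q.2)) q.1.
Definition slope_plus (u : X * R -> R) (q : X * R) : \bar R :=
  limsup_quotient pos_part (fun y => u (y, q.2)) q.1.
Definition slope_minus (u : X * R -> R) (q : X * R) : \bar R :=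
  limsup_quotient neg_part (fun y => u (y, q.2)) q.1.

(* Upper semicontinuous envelope: the neighbourhoods contain the point. *)
Definition slope_env (u : X * R -> R) (q : X * R) : \bar R :=
  limf_esup (slope u) (nbhs q).

Definition dt (u : X * R -> R) (q : X * R) : R :=
  derive1 (fun s => u (q.1, s)) q.2.

Definition locally_lipschitz (psi : X * R -> R) : Prop :=
  forall q, open_spacetime q ->
    exists2 U, nbhs q U & exists K : R, forall a b, U a -> U b ->
      `|psi a - psi b| <= K * (mdist a.1 b.1 + `|a.2 - b.2|).

Definition test_fun (psi : X * R -> R) : Prop :=
  [/\ locally_lipschitz psi,
      forall q, open_spacetime q -> derivable (fun s => psi (q.1, s)) q.2 1 &
      {within open_spacetime, continuous (dt psi)}].

Definition test_fun_over (psi : X * R -> R) : Prop :=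
  [/\ test_fun psi,
      forall q, open_spacetime q -> slope_plus psi q = slope psi q &
      {within open_spacetime, continuous (slope psi)}].

Definition test_fun_under (psi : X * R -> R) : Prop :=
  [/\ test_fun psi,
      forall q, open_spacetime q -> slope_minus psi q = slope psi q &
      {within open_spacetime, continuous (slope psi)}].

Definition ham_inf (H : R -> R) (a p : R) : R :=
  inf [set H p' | p' in [set p' | 0 <= p' /\ `|p' - p| <= a]].
Definition ham_sup (H : R -> R) (a p : R) : R :=
  sup [set H p' | p' in [set p' | 0 <= p' /\ `|p' - p| <= a]].

Definition lsc_on (D : set (X * R)) (u : X * R -> R) : Prop :=
  lower_semicontinuous ((fun q => (u q)%:E) : subspace D -> \bar R).
Definition usc_on (D : set (X * R)) (u : X * R -> R) : Prop :=
  lsc_on D (fun q => - u q).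

Definition local_max (f : X * R -> R) (q : X * R) : Prop :=
  \forall q' \near q, f q' <= f q.
Definition local_min (f : X * R -> R) (q : X * R) : Prop :=
  \forall q' \near q, f q <= f q'.

(* [fine] is harmless below: slopes of locally Lipschitz functions and their
   envelopes are finite on X x (0,oo). *)
Definition viscosity_subsolution (H : R -> R) (u : X * R -> R) : Prop :=
  usc_on open_spacetime u /\
  forall psi1 psi2, test_fun_under psi1 -> test_fun psi2 ->
    let psi := fun q => psi1 q + psi2 q in
    forall q, open_spacetime q -> local_max (fun q' => u q' - psi q') q ->
      dt psi q + ham_inf H (fine (slope_env psi2 q)) (fine (slope psi1 q)) <= 0.

Definition viscosity_supersolution (H : R -> R) (u : X * R -> R) : Prop :=
  lsc_on open_spacetime u /\
  forall psi1 psi2, test_fun_over psi1 -> test_fun psi2 ->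
    let psi := fun q => psi1 q + psi2 q in
    forall q, open_spacetime q -> local_min (fun q' => u q' - psi q') q ->
      0 <= dt psi q + ham_sup H (fine (slope_env psi2 q)) (fine (slope psi1 q)).

Definition viscosity_solution (H : R -> R) (u : X * R -> R) : Prop :=
  viscosity_subsolution H u /\ viscosity_supersolution H u.

Definition linear_growth (x0 : X) (u : X * R -> R) : Prop :=
  exists C : R, forall q, closed_spacetime q ->
    `|u q| <= C * (mdist x0 q.1 + q.2 + 1).

End spacetime.

(* Main.v *)
Require Import Defs.
From mathcomp Require Import ring lra.

(** The solution is identified with its Hopf-Lax evolution by comparing it with
    functions of the distance to a single point, which are admissible test
    functions because in a geodesic space their slope is realised along a
    geodesic towards that point; no doubling of variables is needed.
    - If [v p - H p <= l] for all [p], then [l t + k (d(a, x) - v t)_+^2] is a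
      supersolution of the radial equation, so a point moving at speed [v] pays
      at most [l] per unit time.
    - For the converse bound the radial profile is the conjugate of
      [s H(p) + e p^2] over [0 <= p <= P], an exact C^1 solution of
      [w_s + H(w_r) = 0].
    The missing compactness is supplied by Ekeland's principle, whose
    perturbation [e d(x', .)] is absorbed by the second test function.

    The Hopf-Lax formula makes [u(., t)] Lipschitz uniformly in [t], so
    near-minimisers over a short time [s] lie within [O(s)]. Hence for nearby
    [x, y] with near-minimisers [a, b] the Busemann inequality holds in the
    quadrilateral [x y b a], which passes midpoint convexity from [u(., t)] to
    [u(., t + s)] locally; subdividing a geodesic makes it global, and the
    admissible time step does not depend on [t]. *)

Set Implicit Arguments.
Unset Strict Implicit.
Unset Printing Implicit Defensive.

(** * Ekeland's variational principle on a half-space of times *)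

Section Ekeland.
Context {R : realType} {X : metricType R}.

(** Ekeland's principle with only the space variable penalised: completeness of [X] handles space,
    while the times of the superlevel set stay in [[t0, T1]] and have a cluster point. *)
Lemma ekeland_strip (g : X -> R -> R) (t0 t1 T1 B e : R) (x1 : X) :
  complete_space X -> 0 < e -> t0 <= t1 ->
  (forall x t eta, t0 <= t -> 0 < eta -> exists2 rho, 0 < rho &
     forall y s, t0 <= s -> mdist x y < rho -> `|t - s| < rho ->
       g y s <= g x t + eta) ->
  (forall y s, t0 <= s -> g y s <= B) ->
  (forall y s, t0 <= s -> g x1 t1 <= g y s -> s <= T1) ->
  exists x t, [/\ t0 <= t, g x1 t1 <= g x t &
    forall y s, t0 <= s -> g y s <= g x t + e * mdist x y].
Proof.
move=> cX e0 t01 usc gB gT.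
pose Q := {q : X * R | t0 <= q.2}.
pose G (q : Q) := g (sval q).1 (sval q).2.
pose D (p q : Q) := mdist (sval p).1 (sval q).1.
pose S p q := G p + e * D p q <= G q.
have D0 p q : 0 <= D p q by apply: mdist_ge0.
have Strans p q r : S p q -> S q r -> S p r.
  rewrite /S => pq qr.
  have : e * D p r <= e * (D p q + D q r).
    by rewrite ler_pM2l//; exact: metric_triangle.
  lra.
have Srefl p : S p p by rewrite /S /D mdistxx mulr0 addr0.
(* The index is carried along so that the successor of the n-th point is within [1/(n+1)] of the
   supremum of [G] over the points above it for the order [S]. *)
pose nxt (a b : Q * nat) := [/\ b.2 = a.2.+1, S a.1 b.1 &
  forall q, S a.1 q -> G q <= G b.1 + (a.2.+1%:R)^-1].
have step a : {b | nxt a b}.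
  apply: cid.
  have hs : has_sup [set G q | q in S a.1].
    split; first by exists (G a.1), a.1.
    by exists B => _ [q _ <-]; apply: gB; exact: (svalP q).
  have [|_ [q Sq <-] sq] := sup_adherent (eps := (a.2.+1%:R)^-1) _ hs.
    by rewrite invr_gt0.
  exists (q, a.2.+1); split => //= r Sr.
  rewrite ltrBlDr in sq; apply/ltW; apply: le_lt_trans sq.
  by apply: ub_le_sup; [case: hs|exists r].
have [f [f0 fS]] := dependent_choice step (exist _ (x1, t1) t01 : Q, 0%N).
have fn n : (f n).2 = n.
  by elim: n => [|n IH]; [rewrite f0|have [-> _ _] := fS n; rewrite IH].
pose p n := (f n).1.
have pS n k : S (p n) (p (n + k)%N).
  elim: k => [|k IH]; first by rewrite addn0.
  by rewrite addnS; apply: (Strans _ _ _ IH); have [] := fS (n + k)%N.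
have pS' n m : (n <= m)%N -> S (p n) (p m) by move=> /subnKC <-.
have psup n q : S (p n) q -> G q <= G (p n.+1) + (n.+1%:R)^-1.
  by have [_ _] := fS n; rewrite fn; apply.
pose x n := (sval (p n)).1; pose t n := (sval (p n)).2.
have tt0 n : t0 <= t n by exact: (svalP (p n)).
(* [p m] lies above both [p n] and [p n.+1]: the first bounds its value, the second turns that bound
   into a distance. *)
have xcauchy n m : (n < m)%N -> e * mdist (x n.+1) (x m) <= (n.+1%:R)^-1.
  move=> nm; have := pS' n.+1 m nm; have := psup n (p m) (pS' _ _ (ltnW nm)).
  rewrite /S ; change (mdist (x n.+1) (x m)) with (D (p n.+1) (p m)).
  set w := _^-1; lra.
have [l xl] : exists l : X, x @ \oo --> l.
  have PF : ProperFilter (x @ \oo) by exact: fmap_proper_filter.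
  apply: (cX _ PF); apply: cauchy_exP => r r0.
  have [n _ /(_ n (leqnn n)) /= nr] : \forall n \near \oo, (n.+1%:R)^-1 < e * r.
    near=> n; rewrite invf_plt ?posrE ?mulr_gt0//.
    have: ((e * r)^-1 < n%:R) by near: n; exact: nbhs_infty_gtr.
    by move/lt_trans; apply; rewrite ltr_nat.
  exists (x n.+1); exists n.+1 => //= m /= nm.
  by rewrite ballEmdist/= -(ltr_pM2l e0) (le_lt_trans (xcauchy _ _ nm)).
have [s /andP[s0 sT] clu] : exists2 s, t0 <= s <= T1 & cluster (t @ \oo) s.
  have [|s [si clu]] := @segment_compact _ t0 T1 (t @ \oo) _.
    exists 0%N => // n _ /=; rewrite in_itv/= tt0/=.
    apply: (gT (x n)) => //; have := pS' 0%N n isT; rewrite /S.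
    have -> : G (p 0%N) = g x1 t1 by rewrite /p f0.
    have := mulr_ge0 (ltW e0) (D0 (p 0%N) (p n)); rewrite /G -/(x n) -/(t n).
    lra.
  by exists s => //; move: si; rewrite /= in_itv.
(* Semicontinuity at [(l, s)] is applied at a large index [m] for which [t m] is close to the
   cluster point [s]. *)
have lim n : G (p n) + e * mdist (x n) l <= g l s.
  apply/ler_addgt0Pr => eta eta0.
  have eta2 : 0 < eta / 2 by rewrite divr_gt0.
  have [rho rho0 us] := usc l s (eta / 2) s0 eta2.
  pose r := Num.min rho (eta / 2 / e).
  have r0 : 0 < r by rewrite lt_min rho0 divr_gt0.
  have [N _ xN] := metricType_numDomainType.cvgr_dist_lt xl r0.
  have [_ [[m /= /andP[nm Nm] <-] tms]] :
      [set t m | m in [set m | (n <= m)%N && (N <= m)%N]] `&` ball s rho !=set0.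
    apply: clu; last exact: nbhsx_ballx.
    exists (maxn n N) => // m /=; rewrite geq_max => nm.
    by exists m.
  have xm := xN m Nm; have nmS := pS' n m nm.
  have := us (x m) (t m) (tt0 m).
  move: xm; rewrite lt_min => /andP[xm xm']; rewrite xm tms => /(_ isT isT) gm.
  have : e * mdist (x n) l <= e * mdist (x n) (x m) + eta / 2.
    rewrite -[X in _ + X](mulfVK (lt0r_neq0 e0)) [X in _ + X]mulrC -mulrDr.
    rewrite ler_pM2l// (le_trans (metric_triangle _ (x m) _))// lerD2l.
    by rewrite metric_sym ltW.
  by move: nmS gm; rewrite /S /G /D -/(x n) -/(x m) -/(t n) -/(t m); lra.
exists l, s; split => //.
  have := lim 0%N; rewrite {1}/p f0 /G /=.
  by have := mulr_ge0 (ltW e0) (mdist_ge0 (x 0%N) l); lra.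
(* A point violating the conclusion would lie above every [p n], so its value would exceed [g l s]
   by at most [1/(n+1)] for all n. *)
move=> y r r0; rewrite leNgt; apply/negP => lt.
have Spn n : S (p n) (exist _ (y, r) r0).
  rewrite /S /D /G/= -/(x n) -/(t n).
  have := lim n; rewrite /G -/(x n) -/(t n).
  have : e * mdist (x n) y <= e * (mdist (x n) l + mdist l y).
    by rewrite ler_pM2l//; exact: metric_triangle.
  lra.
have gle n : g y r <= g l s + (n.+1%:R)^-1.
  have := psup n _ (Spn n); have := lim n.+1.
  have := mulr_ge0 (ltW e0) (mdist_ge0 (x n.+1) l).
  by rewrite /G/=; set w := _^-1; lra.
have d0 := mulr_ge0 (ltW e0) (mdist_ge0 l y).
have : 0 < g y r - g l s by lra.
move=> /[dup] h; rewrite -invr_gt0 => h'.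
have [n _ /(_ n (leqnn n)) /= nr] := nbhs_infty_gtr (g y r - g l s)^-1.
have := gle n; apply/negP; rewrite -ltNge -ltrBrDl.
rewrite invf_plt ?posrE//; apply: (lt_trans nr); by rewrite ltr_nat.
Unshelve. all: by end_near.
Qed.
End Ekeland.

(** * Slopes and radial test functions *)

Section Real.
Context {R : realType}.
Implicit Types (f : R -> R) (l r : R).

(** The remainder form, free of division, lets derivatives of truncations and envelopes be checked
    by plain estimates. *)
Lemma is_derive_epsP f r l : is_derive r 1 f l <->
  (forall e, 0 < e -> exists2 rho, 0 < rho & forall h, `|h| < rho ->
     `|f (r + h) - f r - l * h| <= e * `|h|).
Proof.
split=> [df e e0|H].
  have : derivable f r 1 by exact: ex_derive.
  move=> /cvg_toP /(_ derive_val).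
  move=> /cvgrPdist_le /(_ e e0) /nbhs_ballP[rho /= rho0 rhoP].
  exists rho => // h hr; have [->|h0] := eqVneq h 0.
    by rewrite addr0 subrr mulr0 subrr normr0 mulr0.
  have := rhoP h; rewrite /ball/= sub0r normrN => /(_ hr h0).
  rewrite /GRing.scale/= mulr1 => le1.
  have -> : f (r + h) - f r - l * h = - ((l - h^-1 * (f (h + r) - f r)) * h).
    by rewrite addrC (addrC h); field.
  by rewrite normrN normrM ler_pM2r// normr_gt0.
have cv : h^-1 *: ((f \o shift r) (h *: 1) - f r) @[h --> 0^'] --> l.
  apply/cvgrPdist_le => e e0; have [rho rho0 rhoP] := H e e0.
  apply/nbhs_ballP; exists rho => //= h; rewrite /ball/= sub0r normrN => hr h0.
  have := rhoP h hr; rewrite -ler_pdivrMr ?normr_gt0// -normf_div.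
  rewrite /GRing.scale/= mulr1 -normrN.
  by congr (_ <= _); congr Num.norm; rewrite (addrC h); field.
apply: DeriveDef; first by apply/cvg_ex; exists l.
exact: cvg_lim.
Qed.

End Real.

Section Slope.
Context {R : realType} {X : metricType R}.

Lemma nbhs_mdist (x : X) (A : set X) :
  nbhs x A <-> exists2 r : R, 0 < r & forall y, mdist x y < r -> A y.
Proof. exact: metricType_numDomainType.nbhs_mdistP x A. Qed.

(** The parameter [phi] treats [|s|] and [[s]_-] at once. The upper bound holds because the distance
    is 1-Lipschitz; the lower one comes from the geodesic from [x] to [a], on which the distance to
    [a] drops at unit rate. At [x = a] there is no such direction, whence the condition [l = 0]
    there. *)
Lemma limsup_quotient_radial (phi : R -> R) (f : R -> R) (a x : X) (l : R) :
  geodesic_space X ->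
  (forall s, 0 <= phi s <= `|s|) -> (forall s, - s <= phi s) ->
  is_derive (mdist a x) 1 f l -> 0 <= l -> (mdist a x = 0 -> l = 0) ->
  limsup_quotient phi (fun y => f (mdist a y)) x = l%:E.
Proof.
move=> gX phi0 phiN /is_derive_epsP df l0 al; apply/eqP.
rewrite /limsup_quotient eq_le; apply/andP; split.
  apply/lee_addgt0Pr => e e0; rewrite ge_max lee_fin addr_ge0 ?(ltW e0)//=.
  have [rho rho0 fP] := df e e0.
  apply: (@le_trans _ _ (ereal_sup [set (phi (f (mdist a y) - f (mdist a x)) /
      mdist x y)%:E | y in [set y | mdist x y < rho /\ y != x]])).
    apply: ereal_inf_lbound; eexists; last reflexivity.
    by apply/nbhs_mdist; exists rho => // y xy /= yx.
  apply: ub_ereal_sup => _ /= [y [xy yx] <-].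
  have d0 : 0 < mdist x y by rewrite mdist_gt0 eq_sym.
  rewrite -EFinD lee_fin ler_pdivrMr//.
  have hd : `|mdist a y - mdist a x| <= mdist x y.
    rewrite ler_norml; have := metric_triangle a x y.
    have := metric_triangle a y x; rewrite (metric_sym y x); lra.
  have := fP (mdist a y - mdist a x) (le_lt_trans hd xy).
  rewrite [_ + (_ - _)]addrC subrK => h1.
  have /andP[_ h2] := phi0 (f (mdist a y) - f (mdist a x)).
  apply: (le_trans h2).
  have h3 : l * `|mdist a y - mdist a x| <= l * mdist x y by rewrite ler_wpM2l.
  have h4 : e * `|mdist a y - mdist a x| <= e * mdist x y.
    by rewrite ler_wpM2l// ltW.
  have -> : f (mdist a y) - f (mdist a x) =
    (f (mdist a y) - f (mdist a x) - l * (mdist a y - mdist a x)) +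
    l * (mdist a y - mdist a x) by rewrite subrK.
  apply: (le_trans (ler_normD _ _)); rewrite normrM (ger0_norm l0); lra.
have [->|lneq0] := eqVneq l 0; first by rewrite le_max lexx.
have r0 : 0 < mdist a x.
  rewrite lt_neqAle mdist_ge0 andbT eq_sym.
  by apply: contra lneq0 => /eqP/al/eqP.
rewrite le_max; apply/orP; right.
apply: le_ereal_inf_tmp => _ [A /nbhs_mdist[rho rho0 rhoA] <-].
apply/lee_addgt0Pr => e e0; rewrite -leeBlDr//.
have [rho' rho'0 fP] := df e e0.
pose r := mdist a x.
(* The bound [1 / 2] keeps the parameter in [[0, 1]]; the other one keeps the displacement [s * r]
   below [rho] and [rho']. *)
pose s := Num.min (1 / 2) (Num.min (rho / r) (rho' / r) / 2).
have rr : 0 < Num.min (rho / r) (rho' / r) by rewrite lt_min !divr_gt0.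
have s0 : 0 < s by rewrite lt_min !divr_gt0.
have s1 : s <= 1 / 2 by rewrite /s ge_min lexx.
have s2 : s < Num.min (rho / r) (rho' / r).
  by rewrite gt_min; apply/orP; right; move: rr; set z := Num.min _ _; lra.
move: s2; rewrite lt_min !ltr_pdivlMr// => /andP[sr sr'].
have [g [g0 g1 gP]] := gX x a.
have dxy : mdist x (g s) = s * r.
  rewrite -{1}g0 gP ?lexx ?ler01//; last by apply/andP; split; lra.
  by rewrite sub0r normrN gtr0_norm// metric_sym.
have day : mdist a (g s) = r - s * r.
  rewrite -{1}g1 gP ?lexx ?ler01//; last by apply/andP; split; lra.
  by rewrite ger0_norm 1?metric_sym -/r; [ring|lra].
have sr0 : 0 < s * r by rewrite mulr_gt0.
have Ay : A (g s).
  by apply: rhoA; rewrite ?dxy//; rewrite eq_sym -mdist_gt0 dxy.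
apply: (@le_trans _ _ (phi (f (mdist a (g s)) - f (mdist a x)) /
      mdist x (g s))%:E); last by apply: ereal_sup_ubound; exists (g s).
rewrite -EFinB lee_fin dxy ler_pdivlMr//.
have := phiN (f (mdist a (g s)) - f (mdist a x)).
have := fP (- (s * r)); rewrite normrN gtr0_norm// => /(_ sr').
rewrite day -/r ler_norml; lra.
Qed.

End Slope.

Section Spacetime.
Context {R : realType} {X : metricType R}.

Lemma nbhs_spacetime (q : X * R) (A : set (X * R)) :
  nbhs q A <-> exists2 r : R, 0 < r &
    forall y s, mdist q.1 y < r -> `|q.2 - s| < r -> A (y, s).
Proof.
split=> [/nbhs_ballP[r /= r0 rA]|[r r0 rA]].
  by exists r => // y s y1 s1; apply: rA; split => //=; rewrite ballEmdist.
by apply/nbhs_ballP; exists r => // -[y s] [/= + s1]; rewrite ballEmdist => /rA; apply.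
Qed.

Lemma nbhs_plane (z : R * R) (A : set (R * R)) :
  nbhs z A -> exists2 r : R, 0 < r &
    forall y s, `|z.1 - y| < r -> `|z.2 - s| < r -> A (y, s).
Proof.
by move=> /nbhs_ballP[r /= r0 rA]; exists r => // y s y1 s1; apply: rA.
Qed.

Lemma mdist_lipschitz (a x y : X) : `|mdist a x - mdist a y| <= mdist x y.
Proof.
rewrite ler_norml; have := metric_triangle a x y.
have := metric_triangle a y x; rewrite (metric_sym y x); lra.
Qed.

Lemma continuous_polar (a : X) :
  continuous (fun q : X * R => (mdist a q.1, q.2) : R * R).
Proof.
move=> q A /nbhs_plane[r r0 rA]; apply/nbhs_spacetime; exists r => // y s y1 s1.
by apply: rA => //=; apply: le_lt_trans y1; exact: mdist_lipschitz.
Qed.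

Lemma within_continuous_strip (T : R) (u : X * R -> R) :
  {within [set q : X * R | T <= q.2], continuous u} ->
  forall x t e, T <= t -> 0 < e -> exists2 rho, 0 < rho &
    forall y s, T <= s -> mdist x y < rho -> `|t - s| < rho ->
      `|u (x, t) - u (y, s)| < e.
Proof.
move=> /subspace_continuousP cu x t e Tt e0.
have /cvgrPdist_lt /(_ e e0) := cu (x, t) Tt.
move=> /nbhs_spacetime[r r0 rP]; exists r => // y s Ts y1 s1.
exact: (rP y s y1 s1 Ts).
Qed.

Lemma limsup_quotient_bounded (f : X -> R) (x : X) (l : R) :
  0 <= l -> (forall y z, `|f y - f z| <= l * mdist y z) ->
  (0 <= limsup_quotient Num.norm f x <= l%:E)%E.
Proof.
move=> l0 fl; rewrite /limsup_quotient le_max lexx/= ge_max lee_fin l0/=.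
apply: (@le_trans _ _ (ereal_sup [set (`|f y - f x| /
    mdist x y)%:E | y in [set y | y != x]])).
  apply: ereal_inf_lbound; eexists; last reflexivity.
  by apply/nbhs_mdist; exists 1 => // y xy /= yx.
apply: ub_ereal_sup => _ /= [y yx <-].
rewrite lee_fin ler_pdivrMr ?mdist_gt0 1?eq_sym//.
by rewrite metric_sym.
Qed.

(** For the Ekeland perturbation this bounds the radius of the interval of momenta in [ham_inf] and
    [ham_sup]. *)
Lemma slope_env_bounded (f : X * R -> R) (q : X * R) (l : R) :
  0 <= l -> (forall y z t, `|f (y, t) - f (z, t)| <= l * mdist y z) ->
  0 <= fine (slope_env f q) <= l.
Proof.
move=> l0 fl.
have b z : (0 <= slope f z <= l%:E)%E.
  by rewrite /slope; apply: limsup_quotient_bounded.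
have : (0 <= slope_env f q <= l%:E)%E.
  apply/andP; split.
    apply: limf_esup_ge0 => [|z]; last by have /andP[] := b z.
    exact: filter_not_empty.
  apply: (@le_trans _ _ (ereal_sup [set slope f z | z in setT])).
    by apply: ereal_inf_lbound; exists setT => //; exact: filterT.
  by apply: ub_ereal_sup => _ [z _ <-]; have /andP[] := b z.
by case: (slope_env f q) => [r||] //=; rewrite leye_eq andbF.
Qed.

End Spacetime.

(** * Radial functions as test functions *)

Section TestFunctions.
Context {R : realType} {X : metricType R}.
Implicit Types (F Fr Ft : R -> R -> R) (a : X).

Lemma lipschitz_ball (f df : R -> R) (r0 d B x y : R) :
  (forall r : R, is_derive r 1 f (df r)) ->
  (forall r, `|r0 - r| < d -> `|df r| <= B) ->
  `|r0 - x| < d -> `|r0 - y| < d -> `|f x - f y| <= B * `|x - y|.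
Proof.
move=> fd fB; wlog xy : x y / x <= y => [hw xd yd|xd yd].
  have [xy|/ltW yx] := leP x y; first exact: hw.
  by rewrite distrC (distrC x); exact: hw.
have [|c cxy] := MVT_segment xy (fun r _ => fd r).
  by apply: derivable_within_continuous => r _; exact: ex_derive.
rewrite distrC (distrC x) => ->; rewrite normrM ler_wpM2r//.
apply: fB; move: cxy xd yd; rewrite in_itv/= => /andP[c1 c2].
by rewrite !ltr_norml; lra.
Qed.

(** Profiles are C^1 on the whole plane, negative radii included, so that two-sided derivatives make
    sense at the centre. *)
Definition C1_plane F Fr Ft :=
  [/\ forall r t : R, is_derive r 1 (F^~ t) (Fr r t),
      forall r t : R, is_derive t 1 (F r) (Ft r t),
      continuous (fun z : R * R => Fr z.1 z.2) &
      continuous (fun z : R * R => Ft z.1 z.2)].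

Definition radial F a (q : X * R) := F (mdist a q.1) q.2.

Lemma locally_lipschitz_radial F Fr Ft a (q : X * R) : C1_plane F Fr Ft ->
  exists2 U, nbhs q U & exists K : R, forall b c, U b -> U c ->
    `|radial F a b - radial F a c| <= K * (mdist b.1 c.1 + `|b.2 - c.2|).
Proof.
move=> [dr dt cr ct].
have /cvgrPdist_lt /(_ 1 ltr01) /nbhs_plane[/= r1 r10 H1] :=
  cr (mdist a q.1, q.2).
have /cvgrPdist_lt /(_ 1 ltr01) /nbhs_plane[/= r2 r20 H2] :=
  ct (mdist a q.1, q.2).
pose r := Num.min r1 r2.
exists [set z | mdist q.1 z.1 < r /\ `|q.2 - z.2| < r].
  by apply/nbhs_spacetime; exists r; rewrite ?lt_min ?r10.
pose B1 := `|Fr (mdist a q.1) q.2| + 1; pose B2 := `|Ft (mdist a q.1) q.2| + 1.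
exists (B1 + B2) => -[x t] [y s] /= [xr tr] [yr sr].
have polar z : mdist q.1 z < r -> `|mdist a q.1 - mdist a z| < r.
  by apply: le_lt_trans; exact: mdist_lipschitz.
have h1 : `|F (mdist a x) t - F (mdist a y) t| <= B1 * `|mdist a x - mdist a y|.
  apply: (lipschitz_ball (r0 := mdist a q.1) (d := r) (fun r => dr r t));
    [|exact: polar|exact: polar].
  move=> c; rewrite lt_min => /andP[c1 _]; move: tr; rewrite lt_min => /andP[t1 _].
  have := H1 c t c1 t1; rewrite /= distrC => /ltW /(le_trans (lerB_dist _ _)).
  by rewrite lerBlDl.
have h2 : `|F (mdist a y) t - F (mdist a y) s| <= B2 * `|t - s|.
  apply: (lipschitz_ball (r0 := q.2) (d := r) (fun t => dt (mdist a y) t)) => //.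
  move=> c; rewrite lt_min => /andP[_ c1].
  have := polar _ yr; rewrite lt_min => /andP[_ t1].
  have := H2 _ c t1 c1; rewrite /= distrC => /ltW /(le_trans (lerB_dist _ _)).
  by rewrite lerBlDl.
rewrite /radial/= -(subrKA (F (mdist a y) t)) (le_trans (ler_normD _ _))//.
have h3 : B1 * `|mdist a x - mdist a y| <= B1 * mdist x y.
  by rewrite ler_wpM2l ?mdist_lipschitz// /B1 addr_ge0.
have B10 : 0 <= B1 by rewrite addr_ge0.
have B20 : 0 <= B2 by rewrite addr_ge0.
have := mulr_ge0 B10 (normr_ge0 (t - s)).
have := mulr_ge0 B20 (mdist_ge0 x y).
lra.
Qed.

Lemma continuous_radial F Fr Ft a (x : X) t e : C1_plane F Fr Ft -> 0 < e ->
  exists2 rho, 0 < rho & forall y s, mdist x y < rho -> `|t - s| < rho ->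
    `|F (mdist a x) t - F (mdist a y) s| <= e.
Proof.
move=> /(@locally_lipschitz_radial _ _ _ a (x, t)) + e0.
move=> [U /nbhs_spacetime[/= r r0 rU] [K UK]].
have K0 : 0 < 2 * (`|K| + 1) by rewrite mulr_gt0// ltr_wpDl.
exists (Num.min r (e / (2 * (`|K| + 1)))); first by rewrite lt_min r0 divr_gt0.
move=> y s; rewrite !lt_min => /andP[xy /ltW xy'] /andP[ts /ltW ts'].
have := UK (x, t) (y, s); rewrite /radial/=.
move=> /(_ (rU _ _ _ _) (rU _ _ xy ts)); rewrite mdistxx subrr normr0.
move=> /(_ r0 r0) h; apply: (le_trans h).
apply: (@le_trans _ _ ((`|K| + 1) * (mdist x y + `|t - s|))).
  by rewrite ler_wpM2r ?addr_ge0 ?mdist_ge0// (le_trans (ler_norm K))// lerDl.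
apply: (@le_trans _ _ ((`|K| + 1) * (2 * (e / (2 * (`|K| + 1)))))).
  by rewrite ler_pM2l ?ltr_wpDl// mulr_natl mulr2n lerD.
rewrite le_eqVlt; apply/orP; left; apply/eqP; field.
by rewrite gt_eqF// ltr_wpDl.
Qed.

Lemma dt_radial F Fr Ft a : C1_plane F Fr Ft ->
  dt (radial F a) = fun q => Ft (mdist a q.1) q.2.
Proof.
by move=> [_ dF _ _]; apply/funext => q; rewrite /dt derive1E; by case: (dF (mdist a q.1) q.2).
Qed.

Lemma test_fun_radial F Fr Ft a : C1_plane F Fr Ft -> test_fun (radial F a).
Proof.
move=> H; split; first by move=> q _; exact: locally_lipschitz_radial H.
- by move=> q _; case: H => _ dF _ _; case: (dF (mdist a q.1) q.2).
- rewrite (dt_radial _ H); apply: continuous_subspaceT => q.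
  case: H => _ _ _ ct.
  exact: (@continuous_comp _ _ _ _ (fun z : R * R => Ft z.1 z.2) q (@continuous_polar _ _ a q) (ct _)).
Qed.

(** A non-decreasing profile descends fastest towards [a], so [slope_minus] realises the slope;
    [Fr 0 t = 0] excludes a corner at [a]. *)
Lemma test_fun_under_radial F Fr Ft a : geodesic_space X ->
  C1_plane F Fr Ft -> (forall r t, 0 <= Fr r t) -> (forall t, Fr 0 t = 0) ->
  test_fun_under (radial F a) /\
  slope (radial F a) = fun q => (Fr (mdist a q.1) q.2)%:E.
Proof.
move=> gX H Fr0 F0r; have Hsl (phi : R -> R) q :
  (forall s, 0 <= phi s <= `|s|) -> (forall s, - s <= phi s) ->
  limsup_quotient phi (fun y => radial F a (y, q.2)) q.1 =
  (Fr (mdist a q.1) q.2)%:E.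
  move=> p1 p2; apply: (limsup_quotient_radial (f := F^~ q.2) gX p1 p2 _ (Fr0 _ _)).
    by case: H => + _ _ _; apply.
  by move=> ->.
have sl : slope (radial F a) = fun q => (Fr (mdist a q.1) q.2)%:E.
  apply/funext => q; apply: Hsl => s; rewrite ?normr_ge0 ?lexx//.
  by rewrite -normrN ler_norm.
split => //; split.
- exact: test_fun_radial H.
- move=> q _; rewrite sl; apply: Hsl => s; rewrite /neg_part.
    by case: (lerP s 0) => s0; rewrite ?oppr0 ?normr_ge0 ?lexx ?oppr_ge0 ?s0//= ler0_norm.
  by rewrite lerN2 ge_min lexx.
- rewrite sl; apply: continuous_subspaceT => q.
  apply: cvg_EFin; first by apply: nearW.
  case: H => _ _ cr _.
  exact: (@continuous_comp _ _ _ _ (fun z : R * R => Fr z.1 z.2) q (@continuous_polar _ _ a q) (cr _)).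
Qed.

(** A non-increasing profile ascends fastest towards [a]; the slope is computed for [- F] with the
    reflected [phi (- s)]. *)
Lemma test_fun_over_radial F Fr Ft a : geodesic_space X ->
  C1_plane F Fr Ft -> (forall r t, Fr r t <= 0) -> (forall t, Fr 0 t = 0) ->
  test_fun_over (radial F a) /\
  slope (radial F a) = fun q => (- Fr (mdist a q.1) q.2)%:E.
Proof.
move=> gX H Fr0 F0r; have Hsl (phi : R -> R) q :
  (forall s, 0 <= phi s <= `|s|) -> (forall s, s <= phi s) ->
  limsup_quotient phi (fun y => radial F a (y, q.2)) q.1 =
  (- Fr (mdist a q.1) q.2)%:E.
  move=> p1 p2; pose phiN s := phi (- s).
  have -> : limsup_quotient phi (fun y => radial F a (y, q.2)) q.1 =
      limsup_quotient phiN (fun y => - F (mdist a y) q.2) q.1.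
    congr (maxe _ (limf_esup _ _)); apply/funext => y.
    by rewrite /phiN opprB opprK addrC.
  apply: (limsup_quotient_radial (f := fun r => - F r q.2) gX).
  - by move=> s; rewrite -normrN; apply: p1.
  - by move=> s; apply: p2.
  - by case: H => dr _ _ _; apply: is_deriveN.
  - by rewrite oppr_ge0.
  - by move=> ->; rewrite F0r oppr0.
have sl : slope (radial F a) = fun q => (- Fr (mdist a q.1) q.2)%:E.
  by apply/funext => q; apply: Hsl => s; rewrite ?normr_ge0 ?lexx ?ler_norm.
split => //; split.
- exact: test_fun_radial H.
- move=> q _; rewrite sl; apply: Hsl => s; rewrite /pos_part.
    by case: (lerP s 0) => s0; rewrite ?normr_ge0 ?lexx ?(ltW s0)//= ger0_norm// ltW.
  by rewrite le_max lexx.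
- rewrite sl; apply: continuous_subspaceT => q.
  apply: cvg_EFin; first by apply: nearW.
  case: H => _ _ cr _; apply: cvgN.
  exact: (@continuous_comp _ _ _ _ (fun z : R * R => Fr z.1 z.2) q (@continuous_polar _ _ a q) (cr _)).
Qed.

(** This is the Ekeland perturbation; its corner at [a] is harmless, as it enters only as the second
    test function. *)
Lemma test_fun_mdist (c : R) a : test_fun (fun q : X * R => c * mdist a q.1).
Proof.
split.
- move=> q _; exists setT; first exact: filterT.
  exists `|c| => b d _ _; rewrite -mulrBr normrM ler_wpM2l//.
  by rewrite (le_trans (mdist_lipschitz _ _ _))// lerDl.
- move=> q _ /=; exact: (@derivable_cst _ _ _ (c * mdist a q.1)).
- have -> : dt (fun q : X * R => c * mdist a q.1) = cst 0.
    by apply/funext => q; rewrite /dt /= (derive1_cst (c * mdist a q.1)).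
  by apply: continuous_subspaceT => q; exact: cst_continuous.
Qed.

Lemma dtD_mdist (psi : X * R -> R) (c : R) a q :
  dt (fun z => psi z + c * mdist a z.1) q = dt psi q.
Proof.
have E : (fun h : R => h^-1 *: (psi (q.1, h + q.2) + c * mdist a q.1 -
    (psi (q.1, q.2) + c * mdist a q.1))) =
    (fun h : R => h^-1 *: (psi (q.1, h + q.2) - psi (q.1, q.2))).
  by apply/funext => h; rewrite opprD addrACA subrr addr0.
by rewrite /dt /derive1 E.
Qed.

End TestFunctions.

(** * The upper Hopf-Lax bound *)

Section Profiles.
Context {R : realType}.
Implicit Types (x h t v k : R).

Definition pos x := Num.max x 0.
Definition sqpos x := pos x ^+ 2.

Lemma pos_ge0 x : 0 <= pos x. Proof. by rewrite le_max lexx orbT. Qed.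
Lemma pos_ge x : x <= pos x. Proof. by rewrite le_max lexx. Qed.
Lemma pos_id x : 0 <= x -> pos x = x. Proof. by move=> /max_idPl. Qed.
Lemma pos_0 x : x <= 0 -> pos x = 0. Proof. by move=> /max_idPr. Qed.

Lemma pos_lipschitz x y : `|pos x - pos y| <= `|x - y|.
Proof.
rewrite /pos; case: (leP x 0) => x0; case: (leP y 0) => y0.
- by rewrite subrr normr0.
- by rewrite sub0r normrN (gtr0_norm y0) ltr0_norm; lra.
- by rewrite subr0 (gtr0_norm x0) gtr0_norm; lra.
- exact: lexx.
Qed.

Lemma lipschitz_continuous1 (f : R -> R) K :
  (forall x y, `|f x - f y| <= K * `|x - y|) -> continuous f.
Proof.
move=> fK x; apply/cvgrPdist_le => e e0; near=> y.
apply: (le_trans (fK x y)).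
have K1 : 0 < `|K| + 1 by rewrite ltr_wpDl.
apply: (@le_trans _ _ ((`|K| + 1) * `|x - y|)).
  by rewrite ler_wpM2r// (le_trans (ler_norm K))// lerDl.
rewrite -ler_pdivlMl//; near: y; apply: cvgr_dist_le; first exact: cvg_id.
by rewrite mulr_gt0 ?invr_gt0.
Unshelve. all: by end_near. Qed.

Lemma pos_continuous : continuous pos.
Proof.
by apply: (@lipschitz_continuous1 _ 1) => x y; rewrite mul1r pos_lipschitz.
Qed.

Global Instance is_derive_sqpos x : is_derive x 1 sqpos (2 * pos x).
Proof.
apply/is_derive_epsP => e e0; exists e => // h he.
apply: (@le_trans _ _ (`|h| * `|h|)); last by rewrite ler_wpM2r// ltW.
rewrite -normrM [X in _ <= X]ger0_norm -?expr2 ?sqr_ge0// ler_norml /sqpos.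
rewrite /pos; case: (leP x 0) => x0; case: (leP (x + h) 0) => y0.
- by apply/andP; split; nra.
- have : 0 <= (- x) * (x + h + h) by apply: mulr_ge0; lra.
  by move=> ?; apply/andP; split; nra.
- have : 0 <= x * (- h - (x + h)) by apply: mulr_ge0; lra.
  by move=> ?; apply/andP; split; nra.
- by apply/andP; split; nra.
Qed.

Lemma is_derive_sub (f : R -> R) (a x df : R) :
  is_derive (x - a) 1 f df -> is_derive x 1 (fun y => f (y - a)) df.
Proof.
move=> /is_derive_epsP H; apply/is_derive_epsP => e /H[rho r0 rP].
by exists rho => // h /rP; rewrite [x - a + _]addrAC.
Qed.

(* A positive C^1 function with slope in [0, 1], equal to [x + 3h/2] for
   [x >= 0]. *)
Definition ramp h x := h + (sqpos (x + h) - sqpos x) / (2 * h).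
Definition dramp h x := (pos (x + h) - pos x) / h.

Global Instance is_derive_ramp h x : is_derive x 1 (ramp h) (dramp h x).
Proof.
have D1 : is_derive x 1 (fun y => sqpos (y + h)) (2 * pos (x + h)).
  have := is_derive_sub (a := - h) (x := x) (is_derive_sqpos _).
  by rewrite opprK.
rewrite (_ : ramp h = cst h + ((2 * h)^-1 *: ((fun y => sqpos (y + h)) - sqpos))).
  apply: is_derive_eq; rewrite /dramp add0r /GRing.scale/= invfM.
  by set w := h^-1; field.
by apply/funext => y; rewrite /ramp [_ / _]mulrC.
Qed.

Lemma dramp_continuous h : continuous (dramp h).
Proof.
move=> x; apply: cvgMl; apply: cvgB; last exact: pos_continuous.
apply: (@continuous_comp _ _ _ (+%R^~ h) pos); last exact: pos_continuous.
by apply: cvgD; [exact: cvg_id|exact: cvg_cst].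
Qed.

Lemma dramp_le1 h x : 0 < h -> dramp h x <= 1.
Proof.
move=> h0; rewrite ler_pdivrMr// mul1r lerBlDl [pos (x + h)]/pos ge_max.
by rewrite lerD2r pos_ge addr_ge0 ?pos_ge0 ?ltW.
Qed.

Lemma dramp_eq1 h x : 0 < h -> 0 <= x -> dramp h x = 1.
Proof.
move=> h0 x0; rewrite /dramp !pos_id// ?addr_ge0 ?(ltW h0)//.
by rewrite addrC addKr divff ?gt_eqF.
Qed.

Lemma ramp_eq h x : 0 < h -> 0 <= x -> ramp h x = x + 3 / 2 * h.
Proof.
move=> h0 x0; rewrite /ramp /sqpos !pos_id// ?addr_ge0 ?(ltW h0)//.
by field; rewrite gt_eqF.
Qed.

Lemma ramp_ge h x : 0 < h -> h <= ramp h x.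
Proof.
move=> h0; rewrite lerDl divr_ge0 ?mulr_ge0 ?(ltW h0)// subr_ge0.
rewrite ler_pXn2r ?nnegrE ?pos_ge0//.
by rewrite ge_max !le_max lexx orbT andbT lerDl (ltW h0).
Qed.

Lemma ramp_le h x : 0 < h -> x <= 0 -> ramp h x <= 3 / 2 * h.
Proof.
move=> h0 x0; rewrite /ramp /sqpos (pos_0 x0) expr0n/= subr0.
have -> : 3 / 2 * h = h + h ^+ 2 / (2 * h) by field; rewrite gt_eqF.
rewrite lerD2l ler_pM2r ?invr_gt0 ?mulr_gt0//.
rewrite ler_pXn2r ?nnegrE ?pos_ge0 ?(ltW h0)//.
by rewrite ge_max (ltW h0) andbT gerDr.
Qed.

Lemma ramp_gt0 h x : 0 < h -> 0 < ramp h x.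
Proof. by move=> h0; apply: lt_le_trans (ramp_ge _ h0). Qed.

Lemma ramp_continuous h : continuous (ramp h).
Proof.
move=> x; apply: differentiable_continuous; apply/derivable1_diffP.
by case: (is_derive_ramp h x).
Qed.

(* [front] satisfies [w_t + H(w_r) >= 0] at times [t >= t0] as soon as
   [v p - H p <= c] for all [p]. *)
Definition front k v h c e t0 r t : R :=
  k * sqpos (r - v * ramp h (t - t0)) + c * (t - t0) + e * (t - t0) ^+ 2.
Definition front_r k v h t0 r t : R := 2 * k * pos (r - v * ramp h (t - t0)).
Definition front_t k v h c e t0 r t : R :=
  - front_r k v h t0 r t * (v * dramp h (t - t0)) + c + 2 * e * (t - t0).

Lemma front_C1 k v h c e t0 :
  C1_plane (front k v h c e t0) (front_r k v h t0) (front_t k v h c e t0).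
Proof.
have cpos : continuous
    (fun z : R * R => pos (z.1 - v * ramp h (z.2 - t0))).
  move=> z; apply: (@continuous_comp _ _ _
    (fun z : R * R => z.1 - v * ramp h (z.2 - t0)) pos); last exact: pos_continuous.
  apply: cvgB; first exact: cvg_fst.
  apply: cvgMr; apply: (@continuous_comp _ _ _ (fun z : R * R => z.2 - t0)
    (ramp h)); last exact: ramp_continuous.
  by apply: cvgB; [exact: cvg_snd|exact: cvg_cst].
split.
- move=> r t.
  have D := is_derive_sub (is_derive_sqpos (r - v * ramp h (t - t0))).
  rewrite (_ : (front k v h c e t0)^~ t =
    k *: (fun y => sqpos (y - v * ramp h (t - t0))) +
    cst (c * (t - t0) + e * (t - t0) ^+ 2)); last first.
    by apply/funext => y; rewrite /front addrA.
  apply: is_derive_eq; rewrite /front_r addr0 /GRing.scale/=; ring.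
- move=> r t.
  have D := is_derive_sub (is_derive_ramp h (t - t0)).
  have D2 : is_derive t 1 (fun s => r - v * ramp h (s - t0))
      (- (v * dramp h (t - t0))).
    rewrite (_ : (fun s => _) = cst r - v *: (fun s => ramp h (s - t0)))//.
    by apply: is_derive_eq; rewrite sub0r.
  have D3 : is_derive t 1 (sqpos \o (fun s => r - v * ramp h (s - t0)))
      (2 * pos (r - v * ramp h (t - t0)) * - (v * dramp h (t - t0))).
    exact: is_derive1_comp.
  rewrite (_ : front k v h c e t0 r =
    k *: (sqpos \o (fun s => r - v * ramp h (s - t0))) +
    c *: (id - cst t0) + e *: ((id - cst t0) ^+ 2)); last first.
    by apply/funext => y; rewrite /front.
  apply: is_derive_eq; rewrite /front_t /front_r /GRing.scale/= /GRing.scale/=.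
  change ((id - cst t0) t) with (t - t0); ring.
- by move=> z; apply: cvgMr; exact: cpos.
- move=> z; apply: cvgD.
    apply: cvgD; last exact: cvg_cst.
    apply: cvgM; first by apply: cvgN; apply: cvgMr; exact: cpos.
    apply: cvgMr; apply: (@continuous_comp _ _ _ (fun z : R * R => z.2 - t0)
      (dramp h)); last exact: dramp_continuous.
    by apply: cvgB; [exact: cvg_snd|exact: cvg_cst].
  by apply: cvgMr; apply: cvgB; [exact: cvg_snd|exact: cvg_cst].
Qed.

End Profiles.

(** * Comparison of a subsolution with a moving front *)

Section Subsolution.
Context {R : realType} {X : metricType R}.
Implicit Types (H : R -> R) (u : X * R -> R).

Lemma linear_growth_ge0 (x0 : X) u : linear_growth x0 u ->
  exists2 C : R, 0 <= C & forall x t, 0 <= t ->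
    `|u (x, t)| <= C * (mdist x0 x + t + 1).
Proof.
move=> [C HC]; exists `|C| => // x t t0; apply: (le_trans (HC (x, t) t0)).
by rewrite ler_wpM2r ?ler_norm// !addr_ge0 ?mdist_ge0.
Qed.

Lemma quadratic_bound (e D z : R) : 0 < e -> D * z - e * z ^+ 2 <= D ^+ 2 / (4 * e).
Proof.
move=> e0; rewrite ler_pdivlMr ?mulr_gt0//.
have := sqr_ge0 (D - 2 * e * z); nra.
Qed.

(** For [z > 1], division of the hypothesis by [z] bounds [e * z] by [|D| + |N|]. This confines in
    time the superlevel set fed to Ekeland's principle. *)
Lemma quadratic_sublevel (e D N z : R) : 0 < e -> 0 <= z ->
  N <= D * z - e * z ^+ 2 -> z <= 1 + (`|D| + `|N|) / e.
Proof.
move=> e0 z0 h; have [z1|/ltW z1] := leP z 1.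
  by rewrite (le_trans z1)// lerDl divr_ge0 ?addr_ge0// ltW.
apply: (@le_trans _ _ ((`|D| + `|N|) / e)); last by rewrite lerDr.
rewrite ler_pdivlMr// -(ler_pM2r (lt_le_trans ltr01 z1)).
have h1 : D * z <= `|D| * z by rewrite ler_wpM2r// ler_norm.
have h2 : `|N| <= `|N| * z by rewrite ler_peMr.
have h3 := ler_norm (- N); rewrite normrN in h3.
nra.
Qed.

Lemma ham_inf_ge H a p c : 0 <= p -> 0 <= a ->
  (forall p', 0 <= p' -> `|p' - p| <= a -> c <= H p') -> c <= ham_inf H a p.
Proof.
move=> p0 a0 h; apply: lb_le_inf.
  by exists (H p); exists p => //; split => //; rewrite subrr normr0.
by move=> _ [p' [p'0 p'a] <-]; exact: h.
Qed.

(** [u - F] is nearly maximised over [t >= t0], where [F] is the front issued from [a]. As [F] is a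
    strict supersolution, the subsolution test excludes a maximum at [t > t0]; at [t = t0] the front
    dominates the growth of [u] away from [a]. At [(x, t0 + s)] the spatial part of [F] vanishes
    since [mdist a x <= v * s]. *)
Lemma subsolution_upper_bound (x0 : X) H u (t0 s v l : R) (a x : X) :
  complete_space X -> geodesic_space X ->
  {within @closed_spacetime R X, continuous u} -> linear_growth x0 u ->
  viscosity_subsolution H u ->
  0 <= t0 -> 0 < s -> 0 <= v -> (forall p, 0 <= p -> v * p - H p <= l) ->
  mdist a x <= v * s -> u (x, t0 + s) <= u (a, t0) + l * s.
Proof.
move=> cX gX cu /linear_growth_ge0[C C0 uC] [_ visc] t00 s0 v0 vl ax.
have cu' := within_continuous_strip cu.
apply/ler_addgt0Pr => err err0.
(* The three terms pay for the error at time [t0], the excess rate [eta] and the quadratic term in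
   time. *)
pose eta := err / (1 + s + s ^+ 2).
have den0 : 0 < 1 + s + s ^+ 2 by rewrite !addr_gt0 ?exprn_gt0.
have eta0 : 0 < eta by rewrite divr_gt0.
have errE : err = eta * (1 + s + s ^+ 2) by rewrite divfK ?gt_eqF.
have [rho rho0 urho] := cu' a t0 eta t00 eta0.
(* At [t = t0] the front has radius [v * (3 / 2 * h)], which must not exceed [rho / 2]. *)
pose h := rho / (3 * (v + 1)).
have v1 : 0 < v + 1 by lra.
have h0 : 0 < h by rewrite divr_gt0// mulr_gt0.
have vh : v * (3 / 2 * h) <= rho / 2.
  have -> : rho = h * (3 * (v + 1)) by rewrite divfK ?gt_eqF ?mulr_gt0.
  nra.
pose A := C * (mdist x0 a + t0 + 1) + `|u (a, t0)|.
have A0 : 0 <= A by rewrite addr_ge0 ?mulr_ge0 ?addr_ge0 ?mdist_ge0.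
(* Chosen so that [k * (r / 2) ^+ 2] dominates the linear growth [C * r + A] as soon as
   [r >= rho]. *)
pose k := 4 * C / rho + 4 * A / rho ^+ 2.
have k0 : 0 <= k.
  by rewrite addr_ge0// divr_ge0 ?mulr_ge0 ?exprn_ge0 ?(ltW rho0).
have kP r : rho <= r -> 4 * (C * r + A) <= k * r ^+ 2.
  move=> rr; have r1 : 1 <= r / rho by rewrite ler_pdivlMr// mul1r.
  have -> : k * r ^+ 2 = 4 * C * r * (r / rho) + 4 * A * (r / rho) ^+ 2.
    by rewrite /k; field; rewrite gt_eqF.
  have r2 : 1 <= (r / rho) ^+ 2 by rewrite exprn_ege1.
  have : 0 <= C * r by rewrite mulr_ge0// (le_trans (ltW rho0)).
  nra.
pose F := front k v h (l + eta) eta t0.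
have FC1 : C1_plane F _ _ := front_C1 k v h (l + eta) eta t0.
have [tF slF] := @test_fun_under_radial _ X _ _ _ a gX FC1
  (fun r t => mulr_ge0 (mulr_ge0 (ler0n _ _) k0) (pos_ge0 _))
  (fun t => ltac:(rewrite /front_r pos_0 ?mulr0// sub0r oppr_le0 mulr_ge0// ltW//; exact: ramp_gt0)).
pose g y t := u (y, t) - F (mdist a y) t.
(* Linear rate in time of the bound for [u - F], with [C * v] due to the moving edge of the front;
   the quadratic term of [F] overrides it for large times. *)
pose D := C + C * v - l - eta.
pose K := A + C * rho + C * v * (3 / 2 * h).
have gle y t : t0 <= t -> g y t <= K + (D * (t - t0) - eta * (t - t0) ^+ 2).
  move=> tt; have tau0 : 0 <= t - t0 by rewrite subr_ge0.
  have u1 := le_trans (ler_norm _) (uC y t (le_trans t00 tt)).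
  have d1 : C * mdist x0 y <= C * (mdist x0 a + mdist a y).
    by rewrite ler_wpM2l// metric_triangle.
  have uA := normr_ge0 (u (a, t0)).
  rewrite /g /F /front ramp_eq//; set z := mdist a y - _.
  have : C * z <= k * sqpos z + C * rho.
    rewrite /sqpos; have [z1|z1] := leP z rho.
      apply: (@le_trans _ _ (C * rho)); first by rewrite ler_wpM2l.
      by rewrite lerDr mulr_ge0 ?sqr_ge0.
    have zp : 0 <= z by rewrite ltW// (lt_trans rho0).
    rewrite pos_id//; have := kP z (ltW z1).
    have := mulr_ge0 C0 zp; have := mulr_ge0 C0 (ltW rho0); lra.
  rewrite /z /K /D /A; nra.
(* The penalty [eta / (v + 1)] is such that [v] times it stays below the excess rate [eta]. *)
have [|||||x' [t' [tt' ge1 mx]]] := @ekeland_strip _ X g t0 (t0 + s)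
    (t0 + (1 + (`|D| + `|g x (t0 + s) - K|) / eta)) (K + D ^+ 2 / (4 * eta))
    (eta / (v + 1)) x cX _ _ _ _ _.
all: try by rewrite ?divr_gt0// lerDl ltW.
- move=> y t e tt e0; have e2 : 0 < e / 2 by rewrite divr_gt0.
  have [r1 r10 h1] := cu' y t (e / 2) (le_trans t00 tt) e2.
  have [r2 r20 h2] := continuous_radial a y t FC1 e2.
  exists (Num.min r1 r2); first by rewrite lt_min r10.
  move=> z q tq; rewrite !lt_min => /andP[d1 d2] /andP[q1 q2].
  have := h1 z q (le_trans t00 tq) d1 q1; have := h2 z q d2 q2.
  by rewrite /g ltr_norml ler_norml; lra.
- move=> y t tt; apply: (le_trans (gle y t tt)); rewrite lerD2l.
  exact: quadratic_bound.
- move=> y t tt g1; rewrite -lerBlDl; apply: quadratic_sublevel => //.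
    by rewrite subr_ge0.
  by rewrite lerBlDl; exact: le_trans g1 (gle y t tt).
have rampT : F (mdist a x) (t0 + s) = (l + eta) * s + eta * s ^+ 2.
  rewrite /F /front; have -> : t0 + s - t0 = s by ring.
  rewrite ramp_eq ?(ltW s0)// /sqpos pos_0.
    by rewrite expr0n/= mulr0 add0r.
  rewrite subr_le0 (le_trans ax)// ler_wpM2l// lerDl.
  by move: h0; set z := h; lra.
have [tE|tlt] := eqVneq t' t0.
  have : g x' t' <= u (a, t0) + eta.
    rewrite tE /g /F /front subrr ramp_eq// expr0n/= !mulr0 !addr0 add0r.
    have [near|far] := ltP (mdist a x') rho.
      have := urho x' t0 t00 near; rewrite subrr normr0 => /(_ rho0).
      have := mulr_ge0 k0 (sqr_ge0 (pos (mdist a x' - v * (3 / 2 * h)))).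
      by rewrite -/(sqpos _) ltr_norml; lra.
    have zp : mdist a x' / 2 <= mdist a x' - v * (3 / 2 * h) by lra.
    have zp0 : 0 <= mdist a x' - v * (3 / 2 * h).
      by rewrite (le_trans _ zp)// divr_ge0 ?mdist_ge0.
    rewrite /sqpos pos_id//.
    have : k * (mdist a x' / 2) ^+ 2 <= k * (mdist a x' - v * (3 / 2 * h)) ^+ 2.
      by rewrite ler_wpM2l// ler_pXn2r ?nnegrE ?divr_ge0 ?mdist_ge0.
    have := kP _ far.
    have := le_trans (ler_norm _) (uC x' t0 t00).
    have d1 : C * mdist x0 x' <= C * (mdist x0 a + mdist a x').
      by rewrite ler_wpM2l// metric_triangle.
    have := ler_norm (- u (a, t0)); rewrite normrN /A.
    move: d1; set r := mdist a x'; rewrite expr_div_n; lra.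
  move: ge1; rewrite /g rampT errE; lra.
(* At a maximum with [t' > t0] the front has time derivative above [l + eta - v * p], while
   [ham_inf] falls below [v * p - l] by less than [eta]. *)
exfalso; have tlt' : t0 < t' by rewrite lt_neqAle eq_sym tlt.
have e0 : 0 <= eta / (v + 1) by rewrite divr_ge0// ltW.
pose psi2 (q : X * R) := eta / (v + 1) * mdist x' q.1.
have := visc (radial F a) psi2 tF (test_fun_mdist _ _) (x', t')
  (le_lt_trans t00 tlt').
have -> : dt (fun q => radial F a q + psi2 q) (x', t') =
    front_t k v h (l + eta) eta t0 (mdist a x') t'.
  by rewrite dtD_mdist (dt_radial a FC1).
rewrite slF /=.
have psi2P y z t : `|psi2 (y, t) - psi2 (z, t)| <= eta / (v + 1) * mdist y z.
  by rewrite /psi2/= -mulrBr normrM ger0_norm// ler_wpM2l// mdist_lipschitz.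
have /andP[env0 env1] := slope_env_bounded (x', t') e0 psi2P.
set p := front_r _ _ _ _ _ _.
have p0 : 0 <= p by rewrite /p /front_r mulr_ge0 ?pos_ge0 ?mulr_ge0.
move=> /(_ _)/wrap[].
  apply/nbhs_spacetime; exists (t' - t0); first by rewrite subr_gt0.
  move=> y q /= _ /ltr_normlP[_ tq].
  have := mx y q; rewrite /g /psi2/= mdistxx mulr0 /radial/=.
  by move=> /(_ _)/wrap[]; lra.
apply/negP; rewrite -ltNge.
have hi : v * p - v * (eta / (v + 1)) - l <= ham_inf H (fine (slope_env psi2 (x', t'))) p.
  apply: ham_inf_ge => // p' p'0 pp'.
  have := vl p' p'0.
  have : v * (p - p') <= v * (eta / (v + 1)).
    rewrite ler_wpM2l// (le_trans _ env1)// (le_trans _ pp')//.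
    by rewrite distrC ler_norm.
  lra.
apply: (lt_le_trans _ (lerD (lexx _) hi)).
rewrite /front_t -/p dramp_eq1 ?subr_ge0//.
have : v * (eta / (v + 1)) < eta.
  by rewrite mulrCA -[X in _ < X]mulr1 ltr_pM2l// ltr_pdivrMr// mul1r ltrDl.
have : 0 < eta * (t' - t0) by rewrite mulr_gt0// subr_gt0.
lra.
Qed.

End Subsolution.

(** * The lower Hopf-Lax bound *)

Section Conjugate.
Context {R : realType}.
Variable H : R -> R.
Hypothesis H_continuous : {within [set p : R | 0 <= p], continuous H}.
Hypothesis H_nondecreasing : forall p p' : R, 0 <= p -> p <= p' -> H p <= H p'.
Hypothesis H_conv : forall t p q : R, 0 <= t <= 1 -> 0 <= p -> 0 <= q ->
  H (t * p + (1 - t) * q) <= t * H p + (1 - t) * H q.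
Hypothesis H0 : H 0 = 0.
Variables (P e : R).
Hypotheses (P0 : 0 <= P) (e0 : 0 < e).
Implicit Types r s p q : R.

Lemma ham_ge0 p : 0 <= p -> 0 <= H p.
Proof. by move=> p0; rewrite -H0; exact: H_nondecreasing. Qed.

Lemma ham_continuous p eta : 0 <= p -> 0 < eta -> exists2 rho, 0 < rho &
  forall q, 0 <= q -> `|p - q| < rho -> `|H p - H q| <= eta.
Proof.
move=> p0 eta0; have /subspace_continuousP /(_ p p0) := H_continuous.
move=> /cvgrPdist_le /(_ eta eta0) /nbhs_ballP[rho /= rho0 rP].
by exists rho => // q q0 pq; exact: rP.
Qed.

(* [conj r s] is the conjugate of [s H] at [r], with momenta restricted to
   [0, P] and regularised by [e p^2]: the maximiser is then unique, so [conj]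
   is C^1 and solves [w_s + H(w_r) = 0] exactly. *)
Definition penal r s p := p * r - s * H p - e * p ^+ 2.
Definition is_argmax r s p := 0 <= p <= P /\
  forall q, 0 <= q <= P -> penal r s q <= penal r s p.
Definition argmax r s := xget 0 [set p | is_argmax r s p].
Definition conj r s := penal r s (argmax r s).

(** Compactness of [[0, P]] and continuity of [H] give a maximiser, so the default [0] of [xget] is
    never taken. *)
Lemma argmaxP r s : is_argmax r s (argmax r s).
Proof.
suff ex : exists p, [set p | is_argmax r s p] p by exact: (xgetPex 0 ex).
have c1 : {within `[0, P], continuous (fun p : R => p * r)}.
  by apply: continuous_subspaceT => x; apply: cvgMl; exact: cvg_id.
have c2 : {within `[0, P], continuous H}.
  by apply: (continuous_subspaceW _ H_continuous) => y /=; rewrite in_itv/= => /andP[].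
have c3 : {within `[0, P], continuous (fun p : R => e * p ^+ 2)}.
  by apply: continuous_subspaceT => x; apply: cvgMr; exact: exprn_continuous.
have [|p pP pmax] := @EVT_max R (penal r s) 0 P P0.
  move=> x; apply: cvgB; last exact: c3.
  by apply: cvgB; [exact: c1|apply: cvgMr; exact: c2].
exists p; split; first by move: pP; rewrite in_itv.
by move=> q qP; apply: pmax; rewrite in_itv.
Qed.

Lemma argmax_ge0 r s : 0 <= argmax r s.
Proof. by have [/andP[]] := argmaxP r s. Qed.

Lemma argmax_le r s : argmax r s <= P.
Proof. by have [/andP[]] := argmaxP r s. Qed.

Lemma penal_le_conj r s p : 0 <= p <= P -> penal r s p <= conj r s.
Proof. by have [_] := argmaxP r s; apply. Qed.

(** The value at the midpoint of [p] and the maximiser cannot exceed the maximum; convexity of [H]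
    and the square term turn this into strong concavity. *)
Lemma penal_concave r s p : 0 <= s -> 0 <= p <= P ->
  e / 2 * (argmax r s - p) ^+ 2 <= conj r s - penal r s p.
Proof.
move=> s0 pP; rewrite /conj; set q := argmax r s.
have q0 : 0 <= q := argmax_ge0 r s; have qP : q <= P := argmax_le r s.
have /andP[p0 pP'] := pP.
have := @penal_le_conj r s ((p + q) / 2).
rewrite {1}divr_ge0 ?addr_ge0//=.
have -> : (p + q) / 2 <= P by lra.
move=> /(_ isT).
have half01 : ((0 : R) <= 1 / 2) && ((1 / 2 : R) <= 1).
  by apply/andP; split; lra.
have := H_conv half01 p0 q0.
have -> : 1 / 2 * p + (1 - 1 / 2) * q = (p + q) / 2 by field.
move=> /(ler_wpM2l s0); rewrite /conj -/q /penal; nra.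
Qed.

(** Strong concavity at [(r, s)] and at [(r', s')], each tested with the other maximiser, is added
    up; only the increments of [r] and [s] survive. *)
Lemma argmax_holder r s r' s' : 0 <= s -> 0 <= s' ->
  e * (argmax r s - argmax r' s') ^+ 2 <= P * `|r - r'| + H P * `|s - s'|.
Proof.
move=> s0 s'0; set p := argmax r s; set q := argmax r' s'.
have p0 : 0 <= p := argmax_ge0 _ _; have pP : p <= P := argmax_le _ _.
have q0 : 0 <= q := argmax_ge0 _ _; have qP : q <= P := argmax_le _ _.
have := @penal_concave r s q s0; rewrite q0 qP => /(_ isT).
have := @penal_concave r' s' p s'0; rewrite p0 pP => /(_ isT).
rewrite /conj -/p -/q => h1 h2.
have h3 : e * (p - q) ^+ 2 <= (r - r') * (p - q) - (s - s') * (H p - H q).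
  by move: h1 h2; rewrite /penal -(sqrrN (q - p)) opprB; lra.
have a1 : `|p - q| <= P by rewrite ler_norml; apply/andP; split; lra.
have a2 : `|H p - H q| <= H P.
  have := ham_ge0 p0; have := ham_ge0 q0.
  have := H_nondecreasing p0 pP; have := H_nondecreasing q0 qP.
  by move=> *; rewrite ler_norml; apply/andP; split; lra.
apply: (le_trans h3); apply: (le_trans (ler_norm _)).
apply: (le_trans (ler_normB _ _)).
by rewrite !normrM [P * _]mulrC [H P * _]mulrC lerD// ler_wpM2l.
Qed.

Lemma argmax_continuous r s eta : 0 < s -> 0 < eta -> exists2 rho, 0 < rho &
  forall r' s', `|r - r'| < rho -> `|s - s'| < rho ->
    0 < s' /\ `|argmax r s - argmax r' s'| <= eta.
Proof.
move=> s0 eta0; have HP := ham_ge0 P0.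
have D0 : 0 < P + H P + 1 by rewrite ltr_wpDl// addr_ge0.
have n0 : 0 < e * eta ^+ 2 / (P + H P + 1) by rewrite divr_gt0// mulr_gt0// exprn_gt0.
exists (Num.min s (e * eta ^+ 2 / (P + H P + 1))); first by rewrite lt_min s0.
move=> r' s'; rewrite !lt_min => /andP[_ rr] /andP[ss ss'].
have s'0 : 0 < s' by move: ss; rewrite ltr_norml; lra.
split => //; have := @argmax_holder r s r' s' (ltW s0) (ltW s'0).
move=> /le_trans h; rewrite -[X in _ <= X]ger0_norm ?(ltW eta0)//.
rewrite -ler_sqr ?nnegrE// !real_normK ?num_real//.
rewrite -(ler_pM2l e0); apply: h.
apply: (@le_trans _ _ ((P + H P) * (e * eta ^+ 2 / (P + H P + 1)))).
  by rewrite [leRHS]mulrDl lerD// ler_wpM2l// ltW.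
rewrite mulrA ler_pdivrMr// mulrC ler_pM2l ?mulr_gt0 ?exprn_gt0//.
by rewrite lerDl.
Qed.

(** Envelope theorem: testing each maximum with the other maximiser squeezes the remainder between
    [0] and [(q - p) * h], and [q - p] is small by continuity of the maximiser. *)
Lemma is_derive_conj_r r s : 0 < s -> is_derive r 1 (conj^~ s) (argmax r s).
Proof.
move=> s0; apply/is_derive_epsP => eta eta0.
have [rho rho0 rP] := argmax_continuous r s0 eta0.
exists rho => // h hr; have := rP (r + h) s.
rewrite opprD addrA subrr add0r normrN hr subrr normr0 rho0.
move=> /(_ isT isT)[_]; set p := argmax r s; set q := argmax (r + h) s => pq.
apply: (@le_trans _ _ (`|p - q| * `|h|)); last by rewrite ler_wpM2r.
rewrite -normrM.
have h1 : penal r s q <= conj r s by apply: penal_le_conj; rewrite argmax_ge0 argmax_le.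
have h2 : penal (r + h) s p <= conj (r + h) s.
  by apply: penal_le_conj; rewrite argmax_ge0 argmax_le.
move: h1 h2; rewrite /conj -/p -/q /penal => h1 h2.
rewrite -[X in _ <= X]normrN -mulNr opprB [X in _ <= X]ger0_norm; last by lra.
by rewrite ger0_norm; lra.
Qed.

Lemma is_derive_conj_s r s : 0 < s -> is_derive s 1 (conj r) (- H (argmax r s)).
Proof.
move=> s0; apply/is_derive_epsP => eta eta0.
have [rho' rho'0 HP] := ham_continuous (argmax_ge0 r s) eta0.
have rho'2 : 0 < rho' / 2 by rewrite divr_gt0.
have [rho rho0 rP] := argmax_continuous r s0 rho'2.
exists rho => // h hr; have := rP r (s + h).
have -> : s - (s + h) = - h by ring.
rewrite normrN hr subrr normr0 rho0.
move=> /(_ isT isT)[_]; set p := argmax r s; set q := argmax r (s + h) => pq.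
have {}pq : `|H p - H q| <= eta by apply: HP; [exact: argmax_ge0|lra].
apply: (@le_trans _ _ (`|H p - H q| * `|h|)); last by rewrite ler_wpM2r.
rewrite -normrM.
have h1 : penal r s q <= conj r s by apply: penal_le_conj; rewrite argmax_ge0 argmax_le.
have h2 : penal r (s + h) p <= conj r (s + h).
  by apply: penal_le_conj; rewrite argmax_ge0 argmax_le.
move: h1 h2; rewrite /conj -/p -/q /penal => h1 h2.
rewrite [X in _ <= X]ger0_norm; last by lra.
by rewrite ger0_norm; lra.
Qed.

(** At [r = 0] no term of [penal] is positive. The resulting zero radial derivative is what a radial
    test function requires at its centre. *)
Lemma argmax0 s : 0 <= s -> argmax 0 s = 0.
Proof.
move=> s0; have := @penal_le_conj 0 s 0; rewrite lexx P0 => /(_ isT).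
rewrite /conj; have := argmax_ge0 0 s; set p := argmax 0 s => p0.
rewrite /penal H0 expr0n/= !mulr0 !sub0r oppr0 add0r.
have := mulr_ge0 s0 (ham_ge0 p0) => h1 h2.
have : e * p ^+ 2 <= 0 by lra.
by rewrite pmulr_rle0// => h3; apply/eqP; rewrite -sqrf_eq0 eq_le h3 sqr_ge0.
Qed.

Lemma conj0 s : 0 <= s -> conj 0 s = 0.
Proof.
by move=> s0; rewrite /conj argmax0// /penal H0 expr0n/= !mulr0 !subr0.
Qed.

Variables (M h c T : R).
Hypothesis h0 : 0 < h.

(** [ramp h (T - t)] is a positive smooth stand-in for the remaining time, defined also after [T].
    The term with [M] vanishes for [t <= T] and compensates the flattening of the ramp afterwards;
    the term with [c] makes the inequality [w_t + H(|w_r|) < 0] strict. *)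
Definition shrink r t : R :=
  - conj r (ramp h (T - t)) - M * (ramp h (T - t) + (t - T) - 3 / 2 * h)
  - c * (t - T).
Definition shrink_r r t : R := - argmax r (ramp h (T - t)).
Definition shrink_t r t : R :=
  - (H (argmax r (ramp h (T - t))) * dramp h (T - t))
  - M * (1 - dramp h (T - t)) - c.

Lemma is_derive_ramp_rev (t : R) :
  is_derive t 1 (fun t => ramp h (T - t)) (- dramp h (T - t)).
Proof.
have D : is_derive t 1 (fun t : R => T - t) (- 1).
  rewrite (_ : (fun t => _) = cst T - id)//.
  by apply: is_derive_eq; rewrite sub0r.
rewrite -mulrN1.
exact: (is_derive1_comp (g := fun t : R => T - t) (is_derive_ramp h _) D).
Qed.

Lemma is_derive_affine_comb (f g : R -> R) (a b K t : R) :
  is_derive t 1 f a -> is_derive t 1 g b ->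
  is_derive t 1 (fun s => - f s - M * (g s + (s - T) - K) - c * (s - T))
    (- a - M * (b + 1) - c).
Proof.
move=> /is_derive_epsP fa /is_derive_epsP gb; apply/is_derive_epsP => eta eta0.
have M1 : 0 < `|M| + 1 by rewrite ltr_wpDl.
have [|r1 r10 f1] := fa (eta / 2); first by rewrite divr_gt0.
have [|r2 r20 g2] := gb (eta / 2 / (`|M| + 1)); first by rewrite !divr_gt0.
exists (Num.min r1 r2); first by rewrite lt_min r10.
move=> k; rewrite lt_min => /andP[/f1 k1 /g2 k2].
have k3 : `|M| * `|g (t + k) - g t - b * k| <= eta / 2 * `|k|.
  apply: (@le_trans _ _ ((`|M| + 1) * (eta / 2 / (`|M| + 1) * `|k|))).
    by apply: ler_pM => //; rewrite lerDl.
  by rewrite mulrA [_ * (_ / _)]mulrC divfK ?gt_eqF.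
set lhs := (X in `|X|); have -> : lhs = - (f (t + k) - f t - a * k) -
    M * (g (t + k) - g t - b * k) by rewrite /lhs; ring.
by rewrite (le_trans (ler_normB _ _))// normrN normrM; lra.
Qed.

Lemma shrink_C1 : C1_plane shrink shrink_r shrink_t.
Proof.
have S0 t : 0 < ramp h (T - t) by exact: ramp_gt0.
have Scont : continuous (fun z : R * R => ramp h (T - z.2)).
  move=> z; apply: (@continuous_comp _ _ _ (fun z : R * R => T - z.2) (ramp h));
    last exact: ramp_continuous.
  by apply: cvgB; [exact: cvg_cst|exact: cvg_snd].
have dScont : continuous (fun z : R * R => dramp h (T - z.2)).
  move=> z; apply: (@continuous_comp _ _ _ (fun z : R * R => T - z.2) (dramp h));
    last exact: dramp_continuous.
  by apply: cvgB; [exact: cvg_cst|exact: cvg_snd].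
have acont : continuous (fun z : R * R => argmax z.1 (ramp h (T - z.2))).
  move=> z; apply/cvgrPdist_le => eta eta0.
  have [rho rho0 rP] := argmax_continuous z.1 (S0 z.2) eta0.
  have /cvgrPdist_lt /(_ rho rho0) := Scont z.
  have /cvgrPdist_lt /(_ rho rho0) : y.1 @[y --> z] --> z.1 by exact: cvg_fst.
  apply: filterS2 => y y1 y2.
  by have [] := rP _ _ y1 y2.
have Hcont : continuous (fun z : R * R => H (argmax z.1 (ramp h (T - z.2)))).
  move=> z; apply/cvgrPdist_le => eta eta0.
  have [rho rho0 rP] := ham_continuous (argmax_ge0 z.1 (ramp h (T - z.2))) eta0.
  have /cvgrPdist_lt /(_ rho rho0) := acont z.
  by apply: filterS => y y1; apply: rP => //; exact: argmax_ge0.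
split.
- move=> r t; have D := is_derive_conj_r r (S0 t).
  rewrite (_ : shrink^~ t = - (conj^~ (ramp h (T - t))) +
    cst (- (M * (ramp h (T - t) + (t - T) - 3 / 2 * h)) - c * (t - T))); last first.
    by apply/funext => y; rewrite /shrink -addrA.
  by apply: is_derive_eq; rewrite addr0.
- move=> r t; have D := is_derive_ramp_rev t.
  have D2 := is_derive1_comp (g := fun t => ramp h (T - t)) (is_derive_conj_s r (S0 t)) D.
  have -> : shrink_t r t =
      - (- H (argmax r (ramp h (T - t))) * - dramp h (T - t))
      - M * (- dramp h (T - t) + 1) - c by rewrite /shrink_t; ring.
  exact: (is_derive_affine_comb (f := fun t => conj r (ramp h (T - t))) _ D2 D).
- by move=> z; apply: cvgN; exact: acont.
- move=> z; apply: cvgB; last exact: cvg_cst.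
  apply: cvgB.
    by apply: cvgN; apply: cvgM; [exact: Hcont|exact: dScont].
  by apply: cvgMr; apply: cvgB; [exact: cvg_cst|exact: dScont].
Qed.

End Conjugate.

(** * Comparison of a supersolution with the conjugate profile *)

Section Supersolution.
Context {R : realType} {X : metricType R}.
Implicit Types (H : R -> R) (u : X * R -> R).

Lemma ham_sup_le H a p c : 0 <= p -> 0 <= a ->
  (forall p', 0 <= p' -> `|p' - p| <= a -> H p' <= c) -> ham_sup H a p <= c.
Proof.
move=> p0 a0 h; apply: ge_sup.
  by exists (H p); exists p => //; split => //; rewrite subrr normr0.
by move=> _ [p' [p'0 p'a] <-]; exact: h.
Qed.

(** [F - u] is nearly maximised, with [F] centred at [x] and terminal time [T]. The supersolution
    test excludes a maximum at [t > t0], so it lies at [t0] and its position is the near-minimiser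
    [y]. One [y] serves all momenta in [[0, P]], since [conj] is the maximum over them. *)
Lemma supersolution_lower_bound (x0 : X) H u (t0 s P err : R) (x : X) :
  complete_space X -> geodesic_space X ->
  {within [set p : R | 0 <= p], continuous H} ->
  (forall p p' : R, 0 <= p -> p <= p' -> H p <= H p') ->
  (forall t p q : R, 0 <= t <= 1 -> 0 <= p -> 0 <= q ->
    H (t * p + (1 - t) * q) <= t * H p + (1 - t) * H q) ->
  H 0 = 0 ->
  {within @closed_spacetime R X, continuous u} -> linear_growth x0 u ->
  viscosity_supersolution H u ->
  0 <= t0 -> 0 < s -> 0 <= P -> 0 < err ->
  exists y, forall p, 0 <= p <= P ->
    u (y, t0) + p * mdist x y - s * H p <= u (x, t0 + s) + err.
Proof.
move=> cX gX cH mH convH H0 cu /linear_growth_ge0[C C0 uC] [_ visc] t00 s0.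
have cu' := within_continuous_strip cu.
(* Enlarging [P] strengthens the claim; with [C <= P] the conjugate outgrows [u] in space. *)
wlog CP : P / C <= P => [hw P0 err0|P0 err0].
  have [|||y yP] := hw (Num.max C P) => //; first by rewrite le_max lexx.
    by rewrite le_max P0 orbT.
  exists y => p /andP[p0 pP]; apply: yP.
  by rewrite p0 le_max pP orbT.
pose T := t0 + s.
have HP0 : 0 <= H P by rewrite -H0; exact: mH.
have HP1 : 0 <= H (P + 1) by rewrite -H0; apply: mH => //; rewrite addr_ge0.
(* One third of [err] each for the strictness [eta], the shift [3 / 2 * h] of the remaining time and
   the regularisation [e * p ^+ 2]. *)
pose eta := err / 3 / s.
pose h := err / 3 / (3 / 2 * (H P + 1)).
pose e := err / 3 / (P ^+ 2 + 1).
have D1 : 0 < 3 / 2 * (H P + 1) by rewrite mulr_gt0 ?ltr_wpDl.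
have D2 : 0 < P ^+ 2 + 1 by rewrite ltr_wpDl// sqr_ge0.
have eta0 : 0 < eta by rewrite !divr_gt0.
have h0 : 0 < h by rewrite !divr_gt0.
have e0 : 0 < e by rewrite !divr_gt0.
have etaE : eta * s = err / 3 by rewrite divfK ?gt_eqF.
have hE : h * (3 / 2 * (H P + 1)) = err / 3 by rewrite divfK ?gt_eqF.
have eE : e * (P ^+ 2 + 1) = err / 3 by rewrite divfK ?gt_eqF.
clearbody eta h e.
(* [M >= H P] keeps [F] a strict subsolution after [T], and [M > C] beats the growth of [u] in
   time. *)
pose M := H P + C + 1.
have HPM : H P <= M by rewrite /M; lra.
pose F := shrink H P e M h eta T.
have FC1 : C1_plane F _ _ := shrink_C1 cH mH convH H0 P0 e0 M eta T h0.
have [tF slF] := @test_fun_over_radial _ X _ _ _ x gX FC1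
  (fun r t => ltac:(rewrite oppr_le0; exact: argmax_ge0))
  (fun t => ltac:(rewrite /shrink_r argmax0 ?oppr0// ltW//; exact: ramp_gt0)).
pose g y t := F (mdist x y) t - u (y, t).
pose D := M - C + eta.
have D0 : 0 < D by rewrite /D /M; lra.
pose K := C * (mdist x0 x + T + 1) + (s + 3 / 2 * h) * H P + e * P ^+ 2 + M * h / 2.
have M0 : 0 <= M by rewrite /M; lra.
have gle y t : t0 <= t -> g y t <= K - D * (t - T).
  move=> tt.
  have u1 := uC y t (le_trans t00 tt).
  have u2 := ler_norm (- u (y, t)); rewrite normrN in u2.
  have d1 : C * mdist x0 y <= C * (mdist x0 x + mdist x y).
    by rewrite ler_wpM2l// metric_triangle.
  have d2 : C * mdist x y <= P * mdist x y by rewrite ler_wpM2r// mdist_ge0.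
  have Ss : ramp h (T - t) <= s + 3 / 2 * h.
    have [tT|/ltW tT] := leP t T.
      by rewrite ramp_eq// ?subr_ge0// lerD2r /T; lra.
    by rewrite (le_trans (ramp_le h0 _)) ?subr_le0// lerDr ltW.
  have Ss' : ramp h (T - t) * H P <= (s + 3 / 2 * h) * H P by rewrite ler_wpM2r.
  have w1 := @penal_le_conj _ _ cH P e P0 (mdist x y) (ramp h (T - t)) P.
  move: w1; rewrite P0 lexx => /(_ isT); rewrite /penal => w1.
  have m1 : - (M * (ramp h (T - t) + (t - T) - 3 / 2 * h)) <=
      - (M * (t - T)) + M * h / 2.
    have : (t - T) - h / 2 <= ramp h (T - t) + (t - T) - 3 / 2 * h.
      have [tT|/ltW tT] := leP t T.
        by rewrite ramp_eq// ?subr_ge0//; lra.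
      by have := ramp_ge (T - t) h0; lra.
    by move=> /(ler_wpM2l M0); lra.
  move: m1 w1 Ss'; rewrite /g /F /shrink /K /D.
  set S := ramp h (T - t); set r := mdist x y in d1 d2 *.
  set w := conj _ _ _ _ _ => *; lra.
(* The penalty is at most [1], and its product with [H (P + 1)] at most [eta / 2]. *)
have [|||||x' [t' [tt' ge1 mx]]] := @ekeland_strip _ X g t0 T
    (T + (K - g x T) / D) (K + D * s)
    (eta / (2 * (H (P + 1) + 1 + eta))) x cX _ _ _ _ _.
- by rewrite divr_gt0// mulr_gt0// ltr_wpDl// addr_ge0.
- by rewrite lerDl ltW.
- move=> y t e1 tt e10; have e2 : 0 < e1 / 2 by rewrite divr_gt0.
  have [r1 r10 h1] := cu' y t (e1 / 2) (le_trans t00 tt) e2.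
  have [r2 r20 h2] := continuous_radial x y t FC1 e2.
  exists (Num.min r1 r2); first by rewrite lt_min r10.
  move=> z q tq; rewrite !lt_min => /andP[d1 d2] /andP[q1 q2].
  have := h1 z q (le_trans t00 tq) d1 q1; have := h2 z q d2 q2.
  by rewrite /g ltr_norml ler_norml; lra.
- move=> y t tt; apply: (le_trans (gle y t tt)); rewrite lerD2l -mulrN.
  by rewrite ler_pM2l// /T; lra.
- move=> y t tt g1; rewrite -lerBlDl ler_pdivlMr//.
  by have := le_trans g1 (gle y t tt); lra.
have e2 : 0 <= eta / (2 * (H (P + 1) + 1 + eta)).
  by rewrite divr_ge0 ?mulr_ge0 ?addr_ge0// ltW.
have gxT : g x T = - u (x, T).
  have S0 : 0 <= ramp h (T - T) by rewrite ltW// ramp_gt0.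
  rewrite /g /F /shrink mdistxx conj0// ramp_eq ?subrr//.
  by ring.
have [tE|tlt] := eqVneq t' t0.
  exists x' => p pP; move: ge1; rewrite gxT tE /g /F /shrink.
  have -> : T - t0 = s by rewrite /T; ring.
  have -> : t0 - T = - s by rewrite /T; ring.
  rewrite ramp_eq ?(ltW s0)//.
  have := @penal_le_conj _ _ cH P e P0 (mdist x x') (s + 3 / 2 * h) p pP.
  rewrite /penal; set w := conj _ _ _ _ _.
  have /andP[p0 pP'] := pP.
  have : 3 / 2 * h * H p <= 3 / 2 * h * H P.
    by rewrite ler_wpM2l ?mH// mulr_ge0// ltW.
  have : e * p ^+ 2 <= e * P ^+ 2.
    by rewrite ler_pM2l// ler_pXn2r ?nnegrE.
  rewrite -/T; set r := mdist x x'; move: etaE hE eE h0 e0; nra.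
exfalso; have tlt' : t0 < t' by rewrite lt_neqAle eq_sym tlt.
set ep := eta / _ in mx e2.
pose psi2 (q : X * R) := - ep * mdist x' q.1.
have := visc (radial F x) psi2 tF (test_fun_mdist _ _) (x', t')
  (le_lt_trans t00 tlt').
have -> : dt (fun q => radial F x q + psi2 q) (x', t') =
    shrink_t H P e M h eta T (mdist x x') t'.
  by rewrite dtD_mdist (dt_radial x FC1).
rewrite slF /= opprK.
have psi2P y z t : `|psi2 (y, t) - psi2 (z, t)| <= ep * mdist y z.
  have -> : psi2 (y, t) - psi2 (z, t) = - (ep * (mdist x' y - mdist x' z)).
    by rewrite /psi2/=; ring.
  by rewrite normrN normrM (ger0_norm e2) ler_wpM2l// mdist_lipschitz.
have /andP[env0 env1] := slope_env_bounded (x', t') e2 psi2P.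
rewrite /shrink_t; set p := argmax _ _ _ _ _.
have p0 : 0 <= p := argmax_ge0 cH e P0 _ _.
have pP : p <= P := argmax_le cH e P0 _ _.
have HpP : H p <= H P by exact: mH.
move=> /(_ _)/wrap[].
  apply/nbhs_spacetime; exists (t' - t0); first by rewrite subr_gt0.
  move=> y q /= _ /ltr_normlP[_ tq].
  have := mx y q; rewrite /g /psi2/= mdistxx mulr0 /radial/=.
  by move=> /(_ _)/wrap[]; lra.
apply/negP; rewrite -ltNge.
have ep1 : ep <= 1.
  rewrite /ep ler_pdivrMr ?mul1r ?mulr_gt0 ?ltr_wpDl ?addr_ge0//.
  by move: HP1 eta0; lra.
have epH : ep * H (P + 1) <= eta / 2.
  rewrite /ep mulrAC ler_pdivrMr ?mulr_gt0 ?ltr_wpDl ?addr_ge0//.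
  by move: HP1 eta0; nra.
(* Convexity between [p] and [p + 1] bounds the gain of [H] over the increment [ep] by
   [ep * H (P + 1)]. *)
have hi : ham_sup H (fine (slope_env psi2 (x', t'))) p <= H p + eta / 2.
  apply: ham_sup_le => // p' p'0 pp'.
  have pe : p' <= p + ep.
    by have := le_trans (ler_norm _) (le_trans pp' env1); lra.
  apply: (le_trans (mH _ _ p'0 pe)).
  have c01 : 0 <= 1 - ep <= 1 by apply/andP; split; lra.
  have := convH _ _ _ c01 p0 (addr_ge0 p0 ler01).
  have -> : (1 - ep) * p + (1 - (1 - ep)) * (p + 1) = p + ep by ring.
  move=> c1; apply: (le_trans c1).
  have : H (p + 1) <= H (P + 1) by apply: mH; [rewrite addr_ge0|rewrite lerD2r].
  move=> /(ler_wpM2l e2).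
  have : 0 <= H p by rewrite -H0 mH.
  move=> /(mulr_ge0 e2); lra.
have d0 := dramp_le1 (T - t') h0.
have : 0 <= (M - H p) * (1 - dramp h (T - t')).
  by rewrite mulr_ge0 ?subr_ge0// (le_trans HpP).
lra.
Qed.

End Supersolution.

(** * Propagation of convexity *)

Lemma convex_functionP (R : realType) (H : R -> R) :
  @convex_function R R^o [set p : R | 0 <= p] H ->
  forall t p q : R, 0 <= t <= 1 -> 0 <= p -> 0 <= q ->
    H (t * p + (1 - t) * q) <= t * H p + (1 - t) * H q.
Proof.
move=> cH t p q /andP[t0 t1] p0 q0.
by apply: (cH (Itv01 t0 t1)); rewrite inE.
Qed.

Lemma superlinear_ge (R : realType) (H : R -> R) :
  H p / p @[p --> +oo] --> +oo ->
  forall V, exists2 P, 0 < P & forall p, P <= p -> V * p <= H p.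
Proof.
move=> /cvgryPge HP V; have [M [_ MP]] := HP V.
exists (Num.max M 0 + 1); first by rewrite ltr_wpDl// le_max lexx orbT.
move=> p pM; have p0 : 0 < p.
  by apply: lt_le_trans pM; rewrite ltr_wpDl// le_max lexx orbT.
rewrite -ler_pdivlMr//; apply: MP; apply: lt_le_trans pM.
by rewrite (@le_lt_trans _ _ (Num.max M 0)) ?le_max ?lexx// ltrDl.
Qed.

(** * Decay in time and Lipschitz bound in space *)

Section HopfLax.
Context {R : realType} {X : metricType R}.
Variables (H : R -> R) (u : X * R -> R).
Hypothesis H0 : H 0 = 0.
Hypothesis H_ge0 : forall p : R, 0 <= p -> 0 <= H p.
Hypothesis H_large : forall V : R, exists2 P : R, 0 < P & forall p : R, P <= p -> V * p <= H p.
Hypothesis upper : forall (t s v l : R) (a x : X), 0 <= t -> 0 < s -> 0 <= v ->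
  (forall p, 0 <= p -> v * p - H p <= l) ->
  mdist a x <= v * s -> u (x, t + s) <= u (a, t) + l * s.
Hypothesis lower : forall (t s P err : R) (x : X), 0 <= t -> 0 < s -> 0 <= P ->
  0 < err -> exists y, forall p, 0 <= p <= P ->
    u (y, t) + p * mdist x y - s * H p <= u (x, t + s) + err.

Lemma decreasing_in_time t s x : 0 <= t -> 0 < s -> u (x, t + s) <= u (x, t).
Proof.
move=> t0 s0; have := @upper t s 0 0 x x t0 s0 (lexx _).
rewrite mdistxx mul0r lexx addr0; apply => // p p0.
by rewrite mul0r sub0r oppr_le0 H_ge0.
Qed.

(** This matches the upper bound to the lower one, which controls only momenta in [[0, P]]: beyond
    [P] the quantity [v * p - H p] is non-positive, and [p = 0] shows [0 <= l]. *)
Lemma upper_large (t s v l P : R) (a x : X) : 0 <= t -> 0 < s -> 0 <= v ->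
  0 <= P -> (forall p, 0 <= p <= P -> v * p - H p <= l) ->
  (forall p, P <= p -> v * p <= H p) ->
  mdist a x <= v * s -> u (x, t + s) <= u (a, t) + l * s.
Proof.
move=> t0 s0 v0 P0 small large; apply: upper => // p p0.
have [pP|/ltW pP] := leP p P; first by apply: small; rewrite p0.
have := small 0; rewrite lexx P0 mulr0 H0 subr0 => /(_ isT) l0.
by have := large p pP; lra.
Qed.

Variable K : R.
Hypothesis K0 : 0 <= K.
Hypothesis u0_lip : forall x y, u (x, 0) <= u (y, 0) + K * mdist x y.

(** The momentum [p = K] absorbs the Lipschitz variation of the initial datum. *)
Lemma initial_decay s x : 0 <= s -> u (x, 0) - s * H K <= u (x, s).
Proof.
rewrite le_eqVlt => /predU1P[<-|s0]; first by rewrite mul0r subr0.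
apply/ler_addgt0Pr => err err0.
have [y /(_ K)] := lower x (lexx 0) s0 K0 err0.
rewrite K0 lexx add0r => /(_ isT); have := u0_lip x y; lra.
Qed.

(** The interval is split as [s] followed by [t]: the near-minimiser [y] at time [s] is pulled back
    to time [0] by [initial_decay], and the upper bound runs from [(y, 0)] to [(x, t)]. *)
Lemma time_decay t s x : 0 <= t -> 0 <= s -> u (x, t) - s * H K <= u (x, t + s).
Proof.
rewrite le_eqVlt => /predU1P[<-|t0] s0.
  by rewrite add0r; exact: initial_decay.
apply/ler_addgt0Pr => e e0.
pose err := Num.min e 1; have err0 : 0 < err by rewrite lt_min e0 ltr01.
have erre : err <= e by rewrite ge_min lexx.
have err1 : err <= 1 by rewrite ge_min lexx orbT.
(* Bounds the distance to the near-minimiser, because the momentum [K + 1] leaves one unit of slope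
   beyond the Lipschitz constant; [B / t] then bounds the speed. *)
pose B := t * H (K + 1) + s * H K + u (x, t + s) - u (x, 0) + 1.
have [P1 P10 HP1] := H_large (B / t).
pose P := Num.max P1 (K + 1).
have P0 : 0 <= P by rewrite le_max (ltW P10).
have [y yP] := lower x s0 t0 P0 err0.
have K1 : 0 <= K + 1 by rewrite addr_ge0.
have dB : mdist x y <= B.
  have := yP (K + 1); rewrite K1 le_max lexx orbT => /(_ isT).
  have := initial_decay y s0; have := u0_lip x y.
  rewrite addrC in erre *; rewrite (addrC s t) /B; lra.
pose l := (u (x, t + s) + err + s * H K - u (y, 0)) / t.
have lt : l * t = u (x, t + s) + err + s * H K - u (y, 0).
  by rewrite divfK ?gt_eqF.
have := @upper_large 0 t (mdist x y / t) l P y x (lexx _) t0.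
rewrite divr_ge0 ?mdist_ge0 ?(ltW t0)// => /(_ isT P0).
rewrite divfK ?gt_eqF// (metric_sym y x) lexx lt add0r => up.
suff : u (x, t) <= u (y, 0) + (u (x, t + s) + err + s * H K - u (y, 0)) by lra.
apply: up => // p pP.
  rewrite -(ler_pM2r t0) lt mulrBl mulrAC divfK ?gt_eqF//.
  have := yP p pP; have := initial_decay y s0.
  by rewrite (addrC s t); lra.
have pP1 : P1 <= p by move: pP; rewrite /P ge_max => /andP[].
apply: le_trans (HP1 p pP1); rewrite ler_wpM2r ?ler_pM2r ?invr_gt0//.
by rewrite (le_trans (ltW P10)).
Qed.

(** A time [mdist x y] is spent: [time_decay] bounds the loss at [x], and the upper bound at unit
    speed leads from [y] to [x] at rate [P]. *)
Lemma lipschitz_in_space : exists2 L, 0 <= L & forall t, 0 <= t ->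
  forall x y, u (x, t) <= u (y, t) + L * mdist x y.
Proof.
have [P P0 HP] := H_large 1.
exists (P + H K); first by rewrite addr_ge0 ?H_ge0// ltW.
move=> t t0 x y; have [<-|xy] := eqVneq x y; first by rewrite mdistxx mulr0 addr0.
have d0 : 0 < mdist x y by rewrite mdist_gt0.
have := time_decay x t0 (ltW d0).
have := @upper t (mdist x y) 1 P y x t0 d0 ler01.
rewrite mul1r (metric_sym y x) lexx => /(_ _)/wrap[|/(_ isT)]; last by lra.
move=> p p0; have [/HP|pP] := leP P p; last by have := H_ge0 p0; lra.
by move: (ltW P0); lra.
Qed.

End HopfLax.

(** * Midpoint convexity, from local to global, and Busemann quadrilaterals *)

Section Convexity.
Context {R : realType} {X : metricType R}.

Definition midpoint_convex (f : X -> R) := forall x y e, 0 < e ->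
  exists2 z, midpoints x y z & 2 * f z <= f x + f y + e.

Definition locally_midpoint_convex (rho : R) (f : X -> R) :=
  forall x y z, mdist x y <= rho -> midpoints x y z -> 2 * f z <= f x + f y.

Lemma midpoints_sym (x y z : X) : midpoints x y z -> midpoints y x z.
Proof. by move=> [h1 h2]; split; rewrite (metric_sym y x). Qed.

Lemma midpoints_nonempty (x y : X) : geodesic_space X -> midpoints x y !=set0.
Proof.
move=> gX; have [g [g0 g1 gP]] := gX x y; exists (g (1 / 2)).
have half01 : ((0 : R) <= 1 / 2) && ((1 / 2 : R) <= 1).
  by apply/andP; split; lra.
split; rewrite /=.
  rewrite -{1}g0 gP ?lexx ?ler01// sub0r normrN ger0_norm; lra.
by rewrite -{1}g1 gP ?lexx ?ler01// ger0_norm; lra.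
Qed.

(** Increments of [G] are non-decreasing, so a pair symmetric about [m] can be spread outwards one
    step at a time. *)
Lemma discrete_convex (G : nat -> R) (m : nat) :
  (forall i, (i.+2 <= m + m)%N -> 2 * G i.+1 <= G i + G i.+2) ->
  2 * G m <= G 0%N + G (m + m)%N.
Proof.
move=> cG.
have mono i k : (i + k < m + m)%N -> G i.+1 - G i <= G (i + k).+1 - G (i + k)%N.
  elim: k => [|k IH]; first by rewrite addn0.
  rewrite addnS => ik; apply: (le_trans (IH (ltnW ik))).
  by have := cG (i + k)%N ik; lra.
suff H k : (k <= m)%N -> 2 * G m <= G (m - k)%N + G (m + k)%N.
  by have := H m (leqnn m); rewrite subnn.
elim: k => [|k IH] km; first by rewrite subn0 addn0 mulr_natl mulr2n.
have := IH (ltnW km); have := mono (m - k.+1)%N (k + k.+1)%N.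
have -> : ((m - k.+1) + (k + k.+1) = m + k)%N by rewrite addnCA subnK// addnC.
have -> : ((m - k.+1).+1 = m - k)%N by rewrite subnSK.
by rewrite ltn_add2l => /(_ km); rewrite addnS; lra.
Qed.

Lemma midpoint_convex_local (rho : R) (f : X -> R) : geodesic_space X -> 0 < rho ->
  locally_midpoint_convex rho f -> midpoint_convex f.
Proof.
move=> gX rho0 fl x y e e0; have [g [g0 g1 gP]] := gX x y.
have [m _ /(_ m (leqnn m)) /= mP] := nbhs_infty_gtr (mdist x y / rho).
have m0 : 0 < m%:R :> R by apply: le_lt_trans mP; rewrite divr_ge0 ?mdist_ge0 ?ltW.
have dm : mdist x y / m%:R <= rho.
  by rewrite ler_pdivrMr// mulrC -ler_pdivrMr// ltW.
(* An even number of pieces makes the middle of the geodesic a node, and nodes two apart are at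
   distance at most [rho]. *)
pose s i : R := i%:R / (2 * m%:R).
have m2 : 0 < 2 * m%:R :> R by rewrite mulr_gt0.
have s01 i : (i <= m + m)%N -> 0 <= s i <= 1.
  move=> im; apply/andP; split; first by rewrite /s divr_ge0// ltW.
  rewrite /s ler_pdivrMr// mul1r.
  by rewrite -natrM ler_nat mul2n -addnn.
have dist i k : (i + k <= m + m)%N ->
    mdist (g (s i)) (g (s (i + k)%N)) = k%:R / 2 * (mdist x y / m%:R).
  move=> ik; rewrite gP ?s01// ?(leq_trans (leq_addr _ _) ik)//.
  rewrite distrC ger0_norm; last first.
    by rewrite subr_ge0 /s ler_pM2r ?invr_gt0// ler_nat leq_addr.
  by rewrite /s natrD; field; rewrite gt_eqF.
have half : s m = 1 / 2 by rewrite /s; field; rewrite gt_eqF.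
have sE : s (m + m)%N = 1 by rewrite /s natrD; field; rewrite gt_eqF.
have s0 : s 0%N = 0 by rewrite /s mul0r.
exists (g (s m)).
  have d1 := dist 0%N m (leq_addr _ _); rewrite add0n s0 g0 in d1.
  have d2 := dist m m (leqnn _); rewrite sE g1 in d2.
  split; rewrite /= ?d1 1?metric_sym ?d2; field; rewrite gt_eqF//.
have := @discrete_convex (fun i => f (g (s i))) m.
rewrite s0 g0 sE g1 => /(_ _)/wrap[]; last by lra.
move=> i im; apply: fl.
  by rewrite -addn2 dist ?addn2// divff// mul1r.
have d1 := dist i 1%N; rewrite addn1 in d1.
have d2 := dist i.+1 1%N; rewrite addn1 in d2.
have d3 := dist i 2; rewrite addn2 in d3.
have mn : m%:R != 0 :> R by rewrite gt_eqF.
split.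
  by rewrite d1 1?ltnW// d3//; field.
by rewrite metric_sym d2// d3//; field.
Qed.

(** The diagonal from [x] to [b] splits the quadrilateral into triangles with apexes [x] and [b],
    which share the midpoint of the diagonal; all vertices lie in the ball about [x]. *)
Lemma busemann_quadrilateral (delta : R) (x y a b z c : X) :
  geodesic_space X ->
  (forall p x y y' : X, closed_mball p delta x -> closed_mball p delta y ->
    closed_mball p delta y' -> forall z z', midpoints x y z ->
    midpoints x y' z' -> 2 * mdist z z' <= mdist y y') ->
  0 <= delta -> mdist x y <= delta -> mdist x a <= delta -> mdist x b <= delta ->
  midpoints x y z -> midpoints a b c ->
  2 * mdist c z <= mdist x a + mdist y b.
Proof.
move=> gX npc d0 xy xa xb zM cM.
have [m mM] := midpoints_nonempty x b gX.
have xx : closed_mball x delta x by rewrite /closed_mball/= mdistxx.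
have h1 := npc x x y b xx xy xb z m zM mM.
have h2 := npc x b x a xb xx xa m c (midpoints_sym mM) (midpoints_sym cM).
have := metric_triangle c m z; rewrite (metric_sym c m) (metric_sym m z); lra.
Qed.

End Convexity.

(** * One time step preserves midpoint convexity *)

Section Step.
Context {R : realType} {X : metricType R}.
Variables (H : R -> R) (u : X * R -> R).
Hypothesis H0 : H 0 = 0.
Hypothesis H_ge0 : forall p : R, 0 <= p -> 0 <= H p.
Hypothesis H_large : forall V : R, exists2 P : R, 0 < P & forall p : R, P <= p -> V * p <= H p.
Hypothesis upper : forall (t s v l : R) (a x : X), 0 <= t -> 0 < s -> 0 <= v ->
  (forall p, 0 <= p -> v * p - H p <= l) ->
  mdist a x <= v * s -> u (x, t + s) <= u (a, t) + l * s.
Hypothesis lower : forall (t s P err : R) (x : X), 0 <= t -> 0 < s -> 0 <= P ->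
  0 < err -> exists y, forall p, 0 <= p <= P ->
    u (y, t) + p * mdist x y - s * H p <= u (x, t + s) + err.

(** With [p = L + 1] the Lipschitz bound consumes [L] and leaves the distance with coefficient one;
    monotonicity in time removes the values of [u]. *)
Lemma near_minimizer_close (L t s P err : R) (x y : X) : 0 <= L ->
  (forall x y, u (x, t) <= u (y, t) + L * mdist x y) ->
  0 <= t -> 0 < s -> L + 1 <= P ->
  (forall p, 0 <= p <= P ->
    u (y, t) + p * mdist x y - s * H p <= u (x, t + s) + err) ->
  mdist x y <= s * H (L + 1) + err.
Proof.
move=> L0 uL t0 s0 LP /(_ (L + 1)); rewrite LP addr_ge0// => /(_ isT).
have := uL x y; have := decreasing_in_time H_ge0 upper x t0 s0; lra.
Qed.

(** By the Busemann inequality [z] is reached from the midpoint [c] of the near-minimisers at their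
    average speed. The time step keeps the quadrilateral small when [x] and [y] are close, which
    suffices by [midpoint_convex_local]. *)
Lemma convexity_step (delta L : R) (t s : R) : geodesic_space X -> 0 < delta ->
  (forall p x y y' : X, closed_mball p delta x -> closed_mball p delta y ->
    closed_mball p delta y' -> forall z z', midpoints x y z ->
    midpoints x y' z' -> 2 * mdist z z' <= mdist y y') ->
  0 <= L -> (forall x y, u (x, t) <= u (y, t) + L * mdist x y) ->
  0 <= t -> 0 < s -> s * (H (L + 1) + 1) <= delta / 2 ->
  midpoint_convex (fun x => u (x, t)) -> midpoint_convex (fun x => u (x, t + s)).
Proof.
move=> gX delta0 npc L0 uL t0 s0 sd conv.
have delta2 : 0 < delta / 2 by rewrite divr_gt0.
apply: (midpoint_convex_local gX delta2) => x y z xy zM.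
apply/ler_addgt0Pr => e e0.
(* Two errors come from the near-minimisers and one from [c]; [err <= s] keeps [a] and [b] within
   [delta / 2] of [x] and [y]. *)
pose err := Num.min (e / 3) s.
have err0 : 0 < err by rewrite lt_min divr_gt0.
have erre : 3 * err <= e.
  by rewrite -ler_pdivlMl// mulrC ge_min lexx.
have errs : err <= s by rewrite ge_min lexx orbT.
(* [H (L + 1) + 1] bounds the average speed [v] below. *)
have [P1 P10 HP1] := H_large (H (L + 1) + 1).
pose P := Num.max P1 (L + 1).
have P0 : 0 <= P by rewrite le_max (ltW P10).
have LP : L + 1 <= P by rewrite le_max lexx orbT.
have [a aP] := lower x t0 s0 P0 err0.
have [b bP] := lower y t0 s0 P0 err0.
have xa := near_minimizer_close L0 uL t0 s0 LP aP.
have yb := near_minimizer_close L0 uL t0 s0 LP bP.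
have xa' : mdist x a <= delta / 2 by lra.
have yb' : mdist y b <= delta / 2 by lra.
have [c cM ucab] := conv a b err err0.
(* Average speed, and next average rate [l]. Adding the two lower bounds at the same [p] gives
   [v * p - H p <= l] on [[0, P]], which stands for convexity of the Lagrangian. *)
pose v := (mdist x a + mdist y b) / (2 * s).
have s2 : 0 < 2 * s by rewrite mulr_gt0.
have vs : v * (2 * s) = mdist x a + mdist y b by rewrite divfK ?gt_eqF.
have v0 : 0 <= v by rewrite divr_ge0 ?addr_ge0 ?mdist_ge0// ltW.
pose l := (u (x, t + s) + err - u (a, t) + (u (y, t + s) + err - u (b, t))) / (2 * s).
have ls : l * (2 * s) =
    u (x, t + s) + err - u (a, t) + (u (y, t + s) + err - u (b, t)).
  by rewrite divfK ?gt_eqF.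
have cz : mdist c z <= v * s.
  have := @busemann_quadrilateral _ _ delta x y a b z c gX npc (ltW delta0).
  have xb := metric_triangle x y b.
  move=> /(_ _ _ _ zM cM) h; have : 2 * mdist c z <= mdist x a + mdist y b.
    by apply: h; lra.
  by rewrite -vs; lra.
have := upper_large H0 upper t0 s0 v0 P0 _ _ cz => /(_ l).
move=> /(_ _ _)/wrap[].
- move=> p pP; rewrite -(ler_pM2r s2) ls mulrBl mulrAC vs.
  by have := aP p pP; have := bP p pP; lra.
- move=> p; rewrite /P ge_max => /andP[pP1 _].
  apply: le_trans (HP1 p pP1).
  rewrite ler_wpM2r ?(le_trans (ltW P10))// ler_pdivrMr//; lra.
by move: ls ucab; lra.
Qed.

End Step.

Lemma midpoint_convexP (R : realType) (X : metricType R) (f : X -> R) :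
  midpoint_convex f <-> forall x y : X,
    (ereal_inf [set (2 * f z)%:E | z in midpoints x y] <= (f x + f y)%:E)%E.
Proof.
split=> [fM x y|fW x y e e0].
  apply/lee_addgt0Pr => e e0; have [z zM fz] := fM x y e e0.
  apply: (@le_trans _ _ (2 * f z)%:E); last by rewrite -EFinD lee_fin.
  by apply: ereal_inf_lbound; exists z.
have : (ereal_inf [set (2 * f z)%:E | z in midpoints x y] < (f x + f y + e)%:E)%E.
  by apply: (le_lt_trans (fW x y)); rewrite lte_fin ltrDl.
move=> /ereal_inf_lt[_ [z zM <-]]; rewrite lte_fin => fz.
by exists z => //; exact: ltW.
Qed.

Theorem theorem5p1 (R : realType) (X : metricType R) (x0 : X)
    (H : R -> R) (u0 : X -> R) (u : X * R -> R)
    (X_complete : complete_space X)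
    (X_npc : uniform_busemann_npc X)
    (H_continuous : {within [set p : R | 0 <= p], continuous H})
    (H_nondecreasing : forall p p' : R, 0 <= p -> p <= p' -> H p <= H p')
    (H_convex : @convex_function R R^o [set p : R | 0 <= p] H)
    (H0 : H 0 = 0)
    (H_superlinear : H p / p @[p --> +oo] --> +oo)
    (u0_lipschitz : lipschitz_continuous u0)
    (u_continuous : {within @closed_spacetime R X, continuous u})
    (u_growth : linear_growth x0 u)
    (u_solution : viscosity_solution H u)
    (u_initial : forall x : X, u (x, 0) = u0 x)
    (u0_convex : weakly_geodesically_convex u0) :
  forall t : R, 0 <= t -> weakly_geodesically_convex (fun x : X => u (x, t)).
Proof.
have [gX [delta delta0 npc]] := X_npc.
have [sub super] := u_solution.
have H_ge0 (p : R) : 0 <= p -> 0 <= H p.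
  by move=> p0; rewrite -H0; exact: H_nondecreasing.
have H_large := superlinear_ge H_superlinear.
have upper (t s v l : R) (a x : X) : 0 <= t -> 0 < s -> 0 <= v ->
    (forall p, 0 <= p -> v * p - H p <= l) ->
    mdist a x <= v * s -> u (x, t + s) <= u (a, t) + l * s.
  exact: (subsolution_upper_bound X_complete gX u_continuous u_growth sub).
have lower (t s P err : R) (x : X) : 0 <= t -> 0 < s -> 0 <= P -> 0 < err ->
    exists y, forall p, 0 <= p <= P ->
      u (y, t) + p * mdist x y - s * H p <= u (x, t + s) + err.
  exact: (supersolution_lower_bound x X_complete gX H_continuous H_nondecreasing
    (convex_functionP H_convex) H0 u_continuous u_growth super).
have [K HK] := u0_lipschitz.
have u0_lip (x y : X) : u (x, 0) <= u (y, 0) + `|K| * mdist x y.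
  have := le_trans (ler_norm _) (HK x y).
  have : K * mdist x y <= `|K| * mdist x y.
    by rewrite ler_wpM2r ?mdist_ge0// ler_norm.
  by rewrite !u_initial; lra.
have [L L0 uL] := lipschitz_in_space H0 H_ge0 H_large upper lower
  (normr_ge0 K) u0_lip.
have HL : 0 < H (L + 1) + 1 by rewrite ltr_wpDl// H_ge0// addr_ge0.
have conv0 : midpoint_convex (fun x => u (x, 0)).
  have [_ cv] := u0_convex; apply/midpoint_convexP => x y.
  have -> : (fun z => (2 * u (z, 0))%:E) = (fun z => (2 * u0 z)%:E).
    by apply/funext => z; rewrite u_initial.
  by rewrite !u_initial; exact: cv.
move=> t t0; split.
  move=> x; apply/cvgrPdist_lt => e e0.
  have [rho rho0 rhoP] := within_continuous_strip u_continuous x t0 e0.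
  apply/nbhs_mdist; exists rho => // y xy.
  by apply: rhoP => //; rewrite subrr normr0.
apply/midpoint_convexP.
have [->|tn0] := eqVneq t 0; first exact: conv0.
have tpos : 0 < t by rewrite lt_neqAle eq_sym tn0.
(* Largest admissible time step, the same at every starting time because [L] is; [t] is then reached
   in [n] equal steps below it. *)
pose h0 := delta / 2 / (H (L + 1) + 1).
have h00 : 0 < h0 by rewrite !divr_gt0.
have [n _ /(_ n (leqnn n)) /= nP] := nbhs_infty_gtr (t / h0).
have n0 : 0 < n%:R :> R by apply: le_lt_trans nP; rewrite divr_ge0// ltW.
have hn : t / n%:R * (H (L + 1) + 1) <= delta / 2.
  rewrite -ler_pdivlMr// -/h0 ler_pdivrMr// mulrC -ler_pdivrMr//; exact: ltW.
suff iter k : midpoint_convex (fun x => u (x, k%:R * (t / n%:R))).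
  by have := iter n; rewrite mulrC divfK// gt_eqF.
have tn : 0 < t / n%:R by rewrite divr_gt0.
elim: k => [|k IH]; first by rewrite mul0r.
have tk : 0 <= k%:R * (t / n%:R) by rewrite mulr_ge0// ltW.
have := convexity_step H0 H_ge0 H_large upper lower gX delta0 npc L0
  (uL _ tk) tk tn hn IH.
by rewrite -[X in _ + X]mul1r -mulrDl -natr1.
Qed.
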